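(* There exists a tensor norm $\alpha$ such that, for all Banach spaces $X$ and $Y$, $X \otimes_\alpha Y$ is a Banach space, and $\ell_2 \otimes_\alpha \ell_2$ is not subprojective.
   Context: A tensor norm $\alpha$ assigns to each pair of Banach spaces $X,Y$ a norm $\|\cdot\|_\alpha$ on the algebraic tensor product $X\otimes Y$ lying between the injective and the projective tensor norms (so $\|x\otimes y\|_\alpha = \|x\|\|y\|$), such that $\|(T_X\otimes T_Y)(a)\|_\alpha \leq \|T_X\|\|T_Y\|\|a\|_\alpha$ for all $T_X\in B(X,X_0)$, $T_Y\in B(Y,Y_0)$, $a\in X\otimes Y$. $X\otimes_\alpha Y$ denotes the completion of $X\otimes Y$ in this norm. A Banach space $X$ is subprojective if every closed infinite dimensional subspace $Y \subset X$ contains a closed infinite dimensional subspace $Z \subset Y$ that is complemented in $X$. *)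

(* Defs.v *)
From HB Require Import structures.
From mathcomp Require Import all_boot all_order all_algebra.
From mathcomp Require Import generic_quotient ring_quotient.
From mathcomp Require Import complex freeg.
From mathcomp Require Import boolp classical_sets functions reals.
From mathcomp Require Import topology normedtype sequences.

Set Implicit Arguments.
Unset Strict Implicit.
Unset Printing Implicit Defensive.

Import Order.TTheory GRing.Theory Num.Theory.
Import numFieldNormedType.Exports.

Local Open Scope classical_set_scope.
Local Open Scope ring_scope.

(* Banach spaces may be real or complex: everything is parameterized by the
   choice s of the scalar field. *)
Variant scalars := real_scalars | complex_scalars.

Definition scalar_field (R : realType) (s : scalars) : numFieldType :=
  match s with
  | real_scalars => R : numFieldType
  | complex_scalars => R[i] : numFieldType
  end.

Section ScalarField.
Context {R : realType} {s : scalars}.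
Local Notation K := (scalar_field R s).

Definition re : K -> R :=
  match s return scalar_field R s -> R with
  | real_scalars => id
  | complex_scalars => @complex.Re R
  end.

Definition ofR : R -> K :=
  match s return R -> scalar_field R s with
  | real_scalars => id
  | complex_scalars => real_complex R
  end.

(* `|x| is K-valued in the library; nrm x is the same number as a real *)
Definition nrm {V : normedZmodType K} (x : V) : R := re `|x|.

Lemma ofRK : cancel ofR re.
Proof. by rewrite /ofR /re; case: s. Qed.

Lemma ofRD : {morph ofR : x y / x + y}.
Proof. by rewrite /ofR; case: s => x y //=; rewrite rmorphD. Qed.

Lemma ofRM : {morph ofR : x y / x * y}.
Proof. by rewrite /ofR; case: s => x y //=; rewrite rmorphM. Qed.

Lemma ofR0 : ofR 0 = 0.
Proof. by rewrite /ofR; case: s. Qed.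

Lemma ofR1 : ofR 1 = 1.
Proof. by rewrite /ofR; case: s. Qed.

Lemma ofR_le x y : (ofR x <= ofR y) = (x <= y).
Proof. by rewrite /ofR; case: s => //=; rewrite lecR. Qed.

Lemma ofR_lt x y : (ofR x < ofR y) = (x < y).
Proof. by rewrite /ofR; case: s => //=; rewrite ltcR. Qed.

Lemma reK (k : K) : 0 <= k -> ofR (re k) = k.
Proof.
rewrite /ofR /re; move: k; case: s => //= -[a b].
by rewrite lecE /= => /andP[/eqP-> _].
Qed.

End ScalarField.

Section Nrm.
Context {R : realType} {s : scalars}.
Local Notation K := (scalar_field R s).

Lemma ofR_nrm (V : normedZmodType K) (x : V) : ofR (nrm x) = `|x|.
Proof. by rewrite /nrm reK. Qed.

Lemma nrm_le (V W : normedZmodType K) (x : V) (y : W) :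
  (`|x| <= `|y|) = (nrm x <= nrm y).
Proof. by rewrite -!ofR_nrm ofR_le. Qed.

Lemma nrm_ge0 (V : normedZmodType K) (x : V) : 0 <= nrm x.
Proof. by rewrite -(@ofR_le _ s) ofR_nrm ofR0. Qed.

Lemma nrmD (V : normedZmodType K) (x y : V) : nrm (x + y) <= nrm x + nrm y.
Proof. by rewrite -(@ofR_le _ s) ofRD !ofR_nrm ler_normD. Qed.

Lemma nrm0 (V : normedZmodType K) : nrm (0 : V) = 0.
Proof. by rewrite /nrm normr0 -ofR0 ofRK. Qed.

Lemma nrm0_eq0 (V : normedZmodType K) (x : V) : nrm x = 0 -> x = 0.
Proof. by move=> x0; apply/normr0_eq0; rewrite -ofR_nrm x0 ofR0. Qed.

Lemma nrmN (V : normedZmodType K) (x : V) : nrm (- x) = nrm x.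
Proof. by rewrite /nrm normrN. Qed.

Lemma nrmB (V : normedZmodType K) (x y : V) : nrm (x - y) = nrm (y - x).
Proof. by rewrite /nrm distrC. Qed.

Lemma nrmM (x y : K) : nrm (x * y) = nrm x * nrm y.
Proof.
by apply: (can_inj (@ofRK R s)); rewrite ofRM !ofR_nrm normrM.
Qed.

Lemma nrmZ (V : normedModType K) (k : K) (x : V) :
  nrm (k *: x) = nrm k * nrm x.
Proof.
by apply: (can_inj (@ofRK R s)); rewrite ofRM !ofR_nrm normrZ.
Qed.

Lemma nrm_ofR (x : R) : 0 <= x -> nrm (ofR x : K) = x.
Proof.
by move=> x0; rewrite /nrm ger0_norm ?ofRK// -ofR0 ofR_le.
Qed.

End Nrm.

Section QuotientModule.
Context (K : nzRingType) (V : lmodType K) (W : submodClosed V).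
Local Open Scope quotient_scope.

(* The library's quotient of a zmodType is by a zmodClosed predicate, an
   instance which submodClosed does not provide. *)
Definition submod_pred : {pred V} := fun x => x \in W.
Lemma submod_pred_zmod : zmod_closed submod_pred.
Proof.
split=> [|x y xW yW]; first exact: rpred0.
by rewrite -[_ \in _]/(x - y \in W) -scaleN1r rpredD// rpredZ.
Qed.
HB.instance Definition _ := GRing.isZmodClosed.Build V submod_pred
  submod_pred_zmod.

Definition quotmod := Quotient.quot submod_pred.

HB.instance Definition _ := Choice.on quotmod.
HB.instance Definition _ := EqQuotient.on quotmod.
HB.instance Definition _ := GRing.Zmodule.on quotmod.

Definition quotmod_pi (x : V) : quotmod := \pi_quotmod x.

Lemma quotmod_eqP (x y : V) : quotmod_pi x = quotmod_pi y <-> x - y \in W.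
Proof.
rewrite /quotmod_pi; split => [/eqP|xy].
  by rewrite eqmodE /=.
by apply/eqP; rewrite eqmodE.
Qed.

Lemma quotmod_piK (q : quotmod) : quotmod_pi (repr q) = q.
Proof. exact: reprK. Qed.

Lemma quotmod_piD : {morph quotmod_pi : x y / x + y}.
Proof. by move=> x y; rewrite /quotmod_pi; exact: (Quotient.pi_add submod_pred x y). Qed.

Lemma quotmod_piB : {morph quotmod_pi : x y / x - y}.
Proof.
move=> x y; rewrite quotmod_piD; congr (_ + _).
by rewrite /quotmod_pi; exact: (Quotient.pi_opp submod_pred y).
Qed.

Definition quotmod_scale (a : K) (q : quotmod) := quotmod_pi (a *: repr q).

Lemma quotmod_piZ_subproof (a : K) (x : V) :
  quotmod_pi (a *: x) = quotmod_scale a (quotmod_pi x).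
Proof.
apply/quotmod_eqP; rewrite -scalerBr rpredZ//.
by apply/quotmod_eqP; rewrite quotmod_piK.
Qed.

Let scaleA a b q : quotmod_scale a (quotmod_scale b q) = quotmod_scale (a * b) q.
Proof. by rewrite -quotmod_piZ_subproof scalerA. Qed.
Let scale1 : left_id 1 quotmod_scale.
Proof. by move=> q; rewrite /quotmod_scale scale1r quotmod_piK. Qed.
Let scaleDr : right_distributive quotmod_scale +%R.
Proof.
move=> a p q; rewrite -(quotmod_piK p) -(quotmod_piK q) -quotmod_piD.
by rewrite -!quotmod_piZ_subproof scalerDr quotmod_piD.
Qed.
Let scaleDl q : {morph quotmod_scale^~ q : a b / a + b}.
Proof. by move=> a b; rewrite /quotmod_scale scalerDl quotmod_piD. Qed.

HB.instance Definition _ := GRing.Zmodule_isLmodule.Build K quotmod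
  scaleA scale1 scaleDr scaleDl.

Lemma quotmod_piZ (a : K) : {morph quotmod_pi : x / a *: x}.
Proof. exact: quotmod_piZ_subproof. Qed.

Let quotmod_pi_linear : linear quotmod_pi.
Proof. by move=> a x y; rewrite quotmod_piD quotmod_piZ. Qed.
HB.instance Definition _ :=
  GRing.isLinear.Build K V quotmod *:%R quotmod_pi quotmod_pi_linear.

End QuotientModule.

Section Tensor.
Context {K : comNzRingType} (X Y : lmodType K).
Local Notation F := {freeg (X * Y) / K}.

Definition bilinear_relations : set F :=
  [set r | exists a x x' y,
     r = << (a *: x + x', y) >> - a *: << (x, y) >> - << (x', y) >>] `|`
  [set r | exists a x y y',
     r = << (x, a *: y + y') >> - a *: << (x, y) >> - << (x, y') >>].

(* membership in the submodule of F spanned by the bilinear relations *)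
Definition tensor_null : {pred F} := fun r =>
  `[< forall W : set F, bilinear_relations `<=` W ->
        W 0 -> (forall a u v, W u -> W v -> W (a *: u + v)) -> W r >].

Lemma tensor_null_submod : submod_closed tensor_null.
Proof.
split=> [|a u v]; rewrite !unfold_in; first by apply/asboolP => W _ W0 _.
move=> /asboolP uW /asboolP vW; apply/asboolP => W RW W0 WD.
exact: (WD _ _ _ (uW W RW W0 WD) (vW W RW W0 WD)).
Qed.
HB.instance Definition _ :=
  GRing.isSubmodClosed.Build K F tensor_null tensor_null_submod.

Definition tensor := quotmod tensor_null.
HB.instance Definition _ := GRing.Lmodule.on tensor.

Definition tens (x : X) (y : Y) : tensor := quotmod_pi tensor_null << (x, y) >>.

End Tensor.

Arguments tensor_null {K} X Y _.
Arguments tens {K X Y} x y.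
Section TensorLift.
Context {K : comNzRingType} {X Y V : lmodType K}.
Local Notation F := {freeg (X * Y) / K}.

Lemma tens_linearl (y : Y) : linear (tens^~ y : X -> tensor X Y).
Proof.
move=> a x x'; apply/eqP; rewrite -subr_eq0 opprD addrA; apply/eqP.
rewrite /tens -quotmod_piZ -!quotmod_piB -(linear0 (quotmod_pi _)).
apply/quotmod_eqP; rewrite subr0; apply/asboolP => W RW _ _; apply: RW.
by left; exists a, x, x', y.
Qed.

Lemma tens_linearr (x : X) : linear (tens x : Y -> tensor X Y).
Proof.
move=> a y y'; apply/eqP; rewrite -subr_eq0 opprD addrA; apply/eqP.
rewrite /tens -quotmod_piZ -!quotmod_piB -(linear0 (quotmod_pi _)).
apply/quotmod_eqP; rewrite subr0; apply/asboolP => W RW _ _; apply: RW.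
by right; exists a, x, y, y'.
Qed.

Lemma tensZl a (x : X) (y : Y) : tens (a *: x) y = a *: tens x y.
Proof.
have := tens_linearl y a x 0; rewrite addr0 => ->.
have := tens_linearl y 1 0 0; rewrite !scale1r add0r => h.
suff -> : tens (0 : X) y = 0 by rewrite addr0.
by apply: (addrI (tens 0 y)); rewrite -h addr0.
Qed.

Lemma tensorP (a : tensor X Y) :
  exists s : seq (X * Y), a = \sum_(p <- s) tens p.1 p.2.
Proof.
pose r : F := repr a.
exists [seq (coeff p r *: p.1, p.2) | p <- dom r].
rewrite big_map -[LHS]quotmod_piK -[repr a]/r -{1}(freeg_sumE r).
rewrite raddf_sum; apply: eq_bigr => -[x y] _ /=.
rewrite tensZl -quotmod_piZ; congr quotmod_pi.
by apply/eqP/freeg_eqP => p; rewrite coeffZ !coeffU mul1r.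
Qed.

(* For bilinear f, the linear map sending tens x y to f x y: see
   tensor_lift_linear and tensor_lift_tens. Otherwise it depends on the
   representative chosen. *)
Definition tensor_lift (f : X -> Y -> V) (a : tensor X Y) : V :=
  fglift (fun p : X * Y => f p.1 p.2) (repr a : F).

Context (f : X -> Y -> V).
Context (fl : forall y, linear (f^~ y)) (fr : forall x, linear (f x)).

Let g := fun p : X * Y => f p.1 p.2.

Let fgliftD (u v : F) : fglift g (u + v) = fglift g u + fglift g v.
Proof.
have fgB := lift_is_additive g.
have fg0 : fglift g 0 = 0 by have := fgB 0 0; rewrite !subr0 subrr.
have fgN w : fglift g (- w) = - fglift g w.
  by have := fgB 0 w; rewrite fg0 !sub0r.
by have := fgB u (- v); rewrite fgN !opprK.
Qed.

Let fgliftZ a (u : F) : fglift g (a *: u) = a *: fglift g u.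
Proof.
have fg0 : fglift g 0 = 0 by have := lift_is_additive g 0 0; rewrite !subr0 subrr.
rewrite -(freeg_sumE u) scaler_sumr.
have H (s : seq (X * Y)) (G : X * Y -> F) :
    fglift g (\sum_(p <- s) G p) = \sum_(p <- s) fglift g (G p).
  by elim: s => [|p s IH]; rewrite ?big_nil// !big_cons fgliftD IH.
rewrite !H scaler_sumr; apply: eq_bigr => p _.
have -> : a *: << coeff p u *g p >> = << a * coeff p u *g p >>.
  by apply/eqP/freeg_eqP => q; rewrite coeffZ !coeffU mulrA.
by rewrite !liftU scalerA.
Qed.

Lemma tensor_lift_pi (u : F) : tensor_lift f (quotmod_pi (tensor_null X Y) u) = fglift g u.
Proof.
rewrite /tensor_lift -/g.
have fgB := lift_is_additive g.
apply/eqP; rewrite -subr_eq0; apply/eqP; rewrite -fgB.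
have /quotmod_eqP /asboolP : quotmod_pi (tensor_null X Y) (repr (quotmod_pi (tensor_null X Y) u)) = quotmod_pi (tensor_null X Y) u.
  by rewrite quotmod_piK.
move/(_ [set w | fglift g w = 0]); apply.
- move=> w [[a [x [x' [y ->]]]]|[a [x [y [y' ->]]]]] /=;
  rewrite !fgB fgliftZ !liftU !scale1r /g/=.
    by rewrite fl addrAC addrK subrr.
  by rewrite fr addrAC addrK subrr.
- by have := fgB 0 0; rewrite !subr0 subrr.
- by move=> a v w /= v0 w0; rewrite fgliftD fgliftZ v0 w0 scaler0 addr0.
Qed.

Lemma tensor_lift_linear : linear (tensor_lift f).
Proof.
move=> a u v; rewrite -(quotmod_piK u) -(quotmod_piK v) -quotmod_piZ -quotmod_piD.
by rewrite !tensor_lift_pi fgliftD fgliftZ.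
Qed.

Lemma tensor_lift_tens x y : tensor_lift f (tens x y) = f x y.
Proof. by rewrite tensor_lift_pi liftU scale1r. Qed.

End TensorLift.

Section Operators.
Context {R : realType} {s : scalars}.
Local Notation K := (scalar_field R s).

Definition opnorm {X Y : normedModType K} (T : X -> Y) : R :=
  sup [set nrm (T x) | x in [set x | nrm x <= 1]].

Definition dual_ball (X : normedModType K) : set {linear X -> K^o} :=
  [set phi | continuous phi /\ opnorm phi <= 1].

Definition injective_norm {X Y : normedModType K} (a : tensor X Y) : R :=
  sup [set r | exists (phi : {linear X -> K^o}) (psi : {linear Y -> K^o}),
         [/\ dual_ball phi, dual_ball psi
           & r = nrm (tensor_lift (fun x y => phi x * psi y : K^o) a)]].

Definition projective_norm {X Y : normedModType K} (a : tensor X Y) : R :=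
  inf [set r | exists2 l : seq (X * Y),
         a = \sum_(p <- l) tens p.1 p.2 & r = \sum_(p <- l) nrm p.1 * nrm p.2].

Definition tensor_map {X X0 Y Y0 : lmodType K} (T : X -> X0) (S : Y -> Y0)
    (a : tensor X Y) : tensor X0 Y0 :=
  tensor_lift (fun x y => tens (T x) (S y)) a.

End Operators.

Record tensor_norm (R : realType) (s : scalars) := TensorNorm {
  tnorm :> forall X Y : completeNormedModType (scalar_field R s),
    tensor X Y -> R;
  tnormD : forall (X Y : completeNormedModType (scalar_field R s))
      (a b : tensor X Y),
    @tnorm X Y (a + b) <= @tnorm X Y a + @tnorm X Y b;
  tnormZ : forall (X Y : completeNormedModType (scalar_field R s))
      (c : scalar_field R s) (a : tensor X Y),
    @tnorm X Y (c *: a) = nrm c * @tnorm X Y a;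
  tnorm0_eq0 : forall (X Y : completeNormedModType (scalar_field R s))
      (a : tensor X Y),
    @tnorm X Y a = 0 -> a = 0;
  injective_le_tnorm : forall (X Y : completeNormedModType (scalar_field R s))
      (a : tensor X Y),
    injective_norm a <= @tnorm X Y a;
  tnorm_le_projective : forall (X Y : completeNormedModType (scalar_field R s))
      (a : tensor X Y),
    @tnorm X Y a <= projective_norm a;
  tnorm_map : forall (X X0 Y Y0 : completeNormedModType (scalar_field R s))
      (TX : {linear X -> X0}) (TY : {linear Y -> Y0}) (a : tensor X Y),
    continuous TX -> continuous TY ->
    @tnorm X0 Y0 (tensor_map TX TY a) <= opnorm TX * opnorm TY * @tnorm X Y a
}.

Arguments tnorm {R s} t X Y a.

Definition normed_tensor {R : realType} {s : scalars} (alpha : tensor_norm R s)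
  (X Y : completeNormedModType (scalar_field R s)) : Type := tensor X Y.

Section NormedTensor.
Context {R : realType} {s : scalars} (alpha : tensor_norm R s).
Context (X Y : completeNormedModType (scalar_field R s)).
Local Notation K := (scalar_field R s).

HB.instance Definition _ := GRing.Lmodule.on (normed_tensor alpha X Y).

Let norm (a : normed_tensor alpha X Y) : K := ofR (alpha X Y a).

Let normD a b : norm (a + b) <= norm a + norm b.
Proof. by rewrite /norm -ofRD ofR_le tnormD. Qed.
Let normZ c a : norm (c *: a) = `|c| * norm a.
Proof. by rewrite /norm tnormZ ofRM ofR_nrm. Qed.
Let norm0_eq0 a : norm a = 0 -> a = 0.
Proof. by move=> /(congr1 re); rewrite ofRK -ofR0 ofRK => /tnorm0_eq0. Qed.

HB.instance Definition _ := Lmodule_isNormed.Build K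
  (normed_tensor alpha X Y) normD normZ norm0_eq0.

End NormedTensor.

Section Epsilon.
Context {R : realType} {s : scalars}.
Local Notation K := (scalar_field R s).
Context {V : normedModType K}.

Lemma ball_ofR (x : V) (e : R) : ball x (ofR e : K) = [set y | nrm (x - y) < e].
Proof.
by rewrite -ball_normE; apply/seteqP; split=> y /=; rewrite -ofR_nrm ofR_lt.
Qed.

Lemma gt0_ofR (e : K) : 0 < e -> exists2 d : R, 0 < d & e = ofR d.
Proof.
move=> e0; exists (re e); last by rewrite reK// ltW.
by rewrite -(@ofR_lt _ s) reK ?ofR0// ltW.
Qed.

Lemma cauchy_seqP (u : nat -> V) : cauchy (u @ \oo) <->
  forall e : R, 0 < e -> exists N, forall m n, (N <= m)%N -> (N <= n)%N ->
    nrm (u m - u n) < e.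
Proof.
split=> [/cauchyP uC e e0|uC].
  have [|x] := uC (ofR (e / 2)).
    by rewrite -ofR0 ofR_lt divr_gt0.
  rewrite ball_ofR => -[N _ Nx]; exists N => m n mN nN.
  rewrite -(subrK x (u m)) -addrA (le_lt_trans (nrmD _ _))//.
  by rewrite [ltRHS]splitr ltrD// ?(Nx n)//= nrmB; exact: Nx.
apply: cauchy_exP => _ /gt0_ofR[e e0 ->].
have [N Nu] := uC e e0; exists (u N); rewrite ball_ofR.
by exists N => // n /= nN; exact: Nu.
Qed.

Lemma null_seqP (u : nat -> V) : u @ \oo --> (0 : V) <->
  forall e : R, 0 < e -> exists N, forall n, (N <= n)%N -> nrm (u n) < e.
Proof.
split=> [/cvgr0Pnorm_lt u0 e e0|u0].
  have /u0[N _ Nu] : 0 < (ofR e : K) by rewrite -ofR0 ofR_lt.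
  by exists N => n /Nu /=; rewrite -ofR_nrm ofR_lt.
apply/cvgr0Pnorm_lt => _ /gt0_ofR[e e0 ->].
have [N Nu] := u0 _ e0; exists N => // n /= nN.
by rewrite -ofR_nrm ofR_lt Nu.
Qed.

Lemma ler_dist_nrm (x y : V) : `|nrm x - nrm y| <= nrm (x - y).
Proof.
rewrite ler_norml lerBlDr lerNl opprB lerBlDr; apply/andP; split.
  by rewrite nrmB -[leLHS](congr1 nrm (subrK x y)) nrmD.
by rewrite -[leLHS](congr1 nrm (subrK y x)) nrmD.
Qed.

Lemma cvg_nrm_cauchy (u : nat -> V) :
  cauchy (u @ \oo) -> cvgn (fun n => nrm (u n)).
Proof.
move=> /cauchy_seqP uC; apply: cauchy_cvg; apply: cauchy_exP => e e0.
have [N Nu] := uC e e0; exists (nrm (u N)); exists N => // n /= nN.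
by rewrite /ball/= (le_lt_trans (ler_dist_nrm _ _))// Nu.
Qed.

End Epsilon.

Section Completion.
Context {R : realType} {s : scalars}.
Local Notation K := (scalar_field R s).
Context (V : normedModType K).

Definition is_cauchy : {pred nat -> V} := fun u => `[< cauchy (u @ \oo) >].

Lemma is_cauchy_submod : submod_closed is_cauchy.
Proof.
split=> [|a u v]; rewrite !unfold_in.
  apply/asboolP/cauchy_seqP => e e0; exists 0%N => m n _ _.
  by rewrite subrr nrm0.
move=> /asboolP/cauchy_seqP uC /asboolP/cauchy_seqP vC.
apply/asboolP/cauchy_seqP => e e0.
have a0 : 0 < nrm a + 1 by rewrite ltr_wpDl ?nrm_ge0.
have [M Mu] := uC (e / 2 / (nrm a + 1)) (divr_gt0 (divr_gt0 e0 (ltr0Sn _ 1)) a0).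
have [N Nv] := vC (e / 2) (divr_gt0 e0 (ltr0Sn _ 1)).
exists (maxn M N) => m n; rewrite !geq_max => /andP[mM mN] /andP[nM nN].
rewrite [X in nrm X](_ : _ = a *: (u m - u n) + (v m - v n)); last first.
  by rewrite scalerBr opprD addrACA.
rewrite (le_lt_trans (nrmD _ _))// [ltRHS]splitr ler_ltD ?Nv// nrmZ.
rewrite (@le_trans _ _ ((nrm a + 1) * nrm (u m - u n)))//.
  by rewrite ler_wpM2r ?nrm_ge0// lerDl.
by rewrite mulrC -ler_pdivlMr// ltW// Mu.
Qed.
HB.instance Definition _ :=
  GRing.isSubmodClosed.Build K (nat -> V) is_cauchy is_cauchy_submod.

Record cauchy_seq := CauchySeq {
  cauchy_val :> nat -> V; _ : cauchy_val \in is_cauchy }.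
HB.instance Definition _ := [isSub for cauchy_val].
HB.instance Definition _ := [Choice of cauchy_seq by <:].
HB.instance Definition _ := [SubChoice_isSubLmodule of cauchy_seq by <:].

Lemma cauchy_valP (u : cauchy_seq) : cauchy (cauchy_val u @ \oo).
Proof. by have /asboolP := valP u. Qed.

Definition is_null : {pred cauchy_seq} :=
  fun u => `[< cauchy_val u @ \oo --> (0 : V) >].

Lemma is_null_submod : submod_closed is_null.
Proof.
split=> [|a u v]; rewrite !unfold_in; first by apply/asboolP; exact: cvg_cst.
move=> /asboolP u0 /asboolP v0; apply/asboolP.
have := cvgD (cvgZ (cvg_cst a) u0) v0; rewrite scaler0 addr0; exact.
Qed.
HB.instance Definition _ :=
  GRing.isSubmodClosed.Build K cauchy_seq is_null is_null_submod.

Definition completion := quotmod is_null.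
HB.instance Definition _ := GRing.Lmodule.on completion.

Definition completion_norm (q : completion) : R :=
  limn (fun n => nrm (cauchy_val (repr q) n)).

Lemma completion_norm_pi (u : cauchy_seq) :
  completion_norm (quotmod_pi is_null u) = limn (fun n => nrm (cauchy_val u n)).
Proof.
rewrite /completion_norm; set v := repr _.
have /quotmod_eqP /asboolP /null_seqP vu :
    quotmod_pi is_null v = quotmod_pi is_null u by rewrite /v quotmod_piK.
apply/eqP; rewrite -subr_eq0 -limB; last 2 first.
- exact/cvg_nrm_cauchy/cauchy_valP.
- exact/cvg_nrm_cauchy/cauchy_valP.
apply/eqP/cvg_lim => //; apply/cvgr0Pnorm_lt => e /vu[N Nu].
exists N => // n /Nu; apply: le_lt_trans; exact: ler_dist_nrm.
Qed.

Let cvg_nrm (u : cauchy_seq) : cvgn (fun n => nrm (cauchy_val u n)).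
Proof. exact/cvg_nrm_cauchy/cauchy_valP. Qed.

Let norm (q : completion) : K := ofR (completion_norm q).

Let normD p q : norm (p + q) <= norm p + norm q.
Proof.
rewrite /norm -ofRD ofR_le -(quotmod_piK p) -(quotmod_piK q) -quotmod_piD.
rewrite !completion_norm_pi -limD; [|exact: cvg_nrm..].
apply: ler_lim; [exact: cvg_nrm|exact: is_cvgD|].
by apply: nearW => n; exact: nrmD.
Qed.
Let normZ c q : norm (c *: q) = `|c| * norm q.
Proof.
rewrite /norm -(quotmod_piK q) -quotmod_piZ !completion_norm_pi.
rewrite -ofR_nrm -ofRM; congr ofR.
under eq_fun do rewrite nrmZ.
by rewrite (limM (is_cvg_cst _)) ?lim_cst.
Qed.
Let norm0_eq0 q : norm q = 0 -> q = 0.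
Proof.
move=> /(congr1 re); rewrite ofRK -ofR0 ofRK -(quotmod_piK q).
rewrite completion_norm_pi => q0.
rewrite -(linear0 (quotmod_pi is_null)); apply/quotmod_eqP; rewrite subr0.
apply/asboolP/null_seqP => e e0.
have := @cvg_nrm (repr q); rewrite q0 => /cvgr0Pnorm_lt /(_ e e0)[N _ Ne].
by exists N => n /Ne /=; rewrite ger0_norm// nrm_ge0.
Qed.

HB.instance Definition _ := Lmodule_isNormed.Build K completion
  normD normZ norm0_eq0.

Lemma nrm_completion (q : completion) : nrm q = completion_norm q.
Proof. by apply: (can_inj (@ofRK R s)); rewrite ofR_nrm. Qed.

Lemma is_cauchy_cst (v : V) : (fun=> v) \in is_cauchy.
Proof.
apply/asboolP/cauchy_seqP => e e0; exists 0%N => m n _ _.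
by rewrite subrr nrm0.
Qed.

Definition completion_embed (v : V) : completion :=
  quotmod_pi is_null (CauchySeq (is_cauchy_cst v)).

Lemma completion_embed_linear : linear completion_embed.
Proof.
move=> a u v; rewrite /completion_embed -quotmod_piZ -quotmod_piD.
by congr quotmod_pi; apply: val_inj.
Qed.

Lemma nrm_completion_embed (v : V) : nrm (completion_embed v) = nrm v.
Proof. rewrite nrm_completion completion_norm_pi; by apply/cvg_lim => //=; apply: cvg_cst. Qed.

Lemma completion_embed_dense (q : completion) (e : R) : 0 < e ->
  exists v : V, nrm (q - completion_embed v) < e.
Proof.
move=> e0; have /cauchy_seqP /(_ (e / 2))[|N Nq] := cauchy_valP (repr q).
  by rewrite divr_gt0.
exists (cauchy_val (repr q) N); rewrite nrm_completion.
rewrite -{1}(quotmod_piK q) -quotmod_piB completion_norm_pi.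
apply: (@le_lt_trans _ _ (e / 2)); last by rewrite ltr_pdivrMr// ltr_pMr// ltr1n.
apply: limr_le; first exact: cvg_nrm.
by exists N => // n /= nN; exact/ltW/Nq.
Qed.

End Completion.

Definition completed_tensor {R : realType} {s : scalars}
    (alpha : tensor_norm R s) (X Y : completeNormedModType (scalar_field R s)) :
  normedModType (scalar_field R s) := completion (normed_tensor alpha X Y).

Section Subprojective.
Context {R : realType} {s : scalars}.
Local Notation K := (scalar_field R s).
Implicit Types (V : normedModType K).

Definition is_banach V : Prop :=
  forall F : set_system V, ProperFilter F -> cauchy F -> cvg F.

Definition closed_subspace V (Y : set V) : Prop :=
  [/\ Y 0, forall (a : K) u v, Y u -> Y v -> Y (a *: u + v) & closed Y].

(* Y lies in no finite-dimensional subspace of V *)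
Definition infinite_dim V (Y : set V) : Prop :=
  ~ exists (n : nat) (e : 'I_n -> V), forall y, Y y ->
      exists c : 'I_n -> K, y = \sum_(i < n) c i *: e i.

Definition complemented V (Z : set V) : Prop :=
  exists P : {linear V -> V},
    [/\ continuous P, forall v, P (P v) = P v & range P = Z].

Definition subprojective V : Prop :=
  forall Y : set V, closed_subspace Y -> infinite_dim Y ->
  exists Z : set V,
    [/\ Z `<=` Y, closed_subspace Z, infinite_dim Z & complemented Z].

End Subprojective.

Lemma Rcomplete_eps (R : realType) (F : set_system R) : ProperFilter F ->
  (forall e : R, 0 < e -> exists z, F [set w | `|w - z| < e]) ->
  exists l, forall e : R, 0 < e -> F [set w | `|w - l| < e].
Proof.
move=> FF Fc; have /R_complete : cauchy F.
  apply: cauchy_exP => e /Fc[z Fz]; exists z; apply: filterS Fz => w /=.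
  by rewrite /ball/= distrC.
move=> /cvg_ex[l Fl]; exists l => e e0.
by move/cvgrPdistC_lt : Fl => /(_ e e0).
Qed.

Lemma scalar_complete (R : realType) (s : scalars)
    (F : set_system (scalar_field R s)) : ProperFilter F ->
  (forall e : R, 0 < e -> exists z, F [set w | nrm (w - z) < e]) ->
  exists l, forall e : R, 0 < e -> F [set w | nrm (w - l) < e].
Proof.
case: s F => [|] F FF Fc; first exact: Rcomplete_eps.
have proj (p : R[i] -> R) : (forall z w, `|p w - p z| <= nrm (w - z : scalar_field R complex_scalars)) ->
    exists l, forall e : R, 0 < e -> F [set w | `|p w - l| < e].
  move=> p1; have [|l Fl] := @Rcomplete_eps R (p @ F) _ _.
    move=> e /Fc[z Fz]; exists (p z).
    suff : F (p @^-1` [set w | `|w - p z| < e]) by [].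
    by apply: filterS Fz => w; exact: le_lt_trans.
  by exists l.
have Re_le (z : R[i]) : `|complex.Re z| <= nrm (z : scalar_field R complex_scalars).
  case: z => a b; rewrite /nrm/= -sqrtr_sqr ler_wsqrtr// lerDl sqr_ge0//.
have Im_le (z : R[i]) : `|complex.Im z| <= nrm (z : scalar_field R complex_scalars).
  case: z => a b; rewrite /nrm/= -sqrtr_sqr ler_wsqrtr// lerDr sqr_ge0//.
have [|l1 F1] := proj (@complex.Re R).
  by move=> [a b] [c d]; exact: (Re_le (Complex (c - a) (d - b))).
have [|l2 F2] := proj (@complex.Im R).
  by move=> [a b] [c d]; exact: (Im_le (Complex (c - a) (d - b))).
exists (Complex l1 l2) => e e0.
have e20 : 0 < e / 2 by rewrite divr_gt0.
apply: filterS2 (F1 _ e20) (F2 _ e20) => -[a b] a1 b2.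
have -> : [set w : scalar_field R complex_scalars | nrm (w - Complex l1 l2) < e]
    (Complex a b) =
  (nrm ((Complex (a - l1) 0 : scalar_field R complex_scalars) +
    (Complex 0 (b - l2) : scalar_field R complex_scalars)) < e) :> Prop.
  congr (is_true (nrm _ < e)); apply/eqP; rewrite eq_complex/=.
  by rewrite addr0 add0r !eqxx.
rewrite (le_lt_trans (nrmD _ _))// [ltRHS]splitr ltrD//.
  by rewrite /nrm/= expr0n/= addr0 sqrtr_sqr.
by rewrite /nrm/= expr0n/= add0r sqrtr_sqr.
Qed.

Section Ell2Sum.
Context {R : realType}.
Implicit Types (a b : nat -> R) (n : nat).

Definition l2sum a n := Num.sqrt (\sum_(0 <= i < n) a i ^+ 2).

Lemma sqr_l2sum a n : l2sum a n ^+ 2 = \sum_(0 <= i < n) a i ^+ 2.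
Proof. by rewrite sqr_sqrtr// sumr_ge0// => i _; rewrite sqr_ge0. Qed.

Lemma l2sum_ge0 a n : 0 <= l2sum a n.
Proof. exact: sqrtr_ge0. Qed.

Lemma l2sumS a n : l2sum a n.+1 = Num.sqrt (l2sum a n ^+ 2 + a n ^+ 2).
Proof. by rewrite sqr_l2sum /l2sum big_nat_recr. Qed.

Lemma ler_l2sum a b n : (forall i, (i < n)%N -> `|a i| <= b i) ->
  l2sum a n <= l2sum b n.
Proof.
move=> ab; rewrite ler_wsqrtr// !big_mkord; apply: ler_sum => i _.
rewrite -real_normK ?num_real// ler_sqr ?nnegrE ?ab//.
by rewrite (le_trans _ (ab _ (ltn_ord i))).
Qed.

Lemma l2sumD a b n : l2sum (fun i => a i + b i) n <= l2sum a n + l2sum b n.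
Proof.
elim: n => [|n IH]; first by rewrite /l2sum !big_geq// sqrtr0 addr0.
have E (x y : R) : Num.sqrt (x ^+ 2 + y ^+ 2) =
    nrm (Complex x y : scalar_field R complex_scalars) by [].
rewrite !l2sumS !E; apply: le_trans (nrmD _ _); rewrite -!E /=.
rewrite ler_wsqrtr// lerD2r ler_sqr ?nnegrE//; first exact: l2sum_ge0.
by rewrite addr_ge0// l2sum_ge0.
Qed.

Lemma l2sumZ (c : R) a n : 0 <= c -> l2sum (fun i => c * a i) n = c * l2sum a n.
Proof.
move=> c0; rewrite /l2sum (eq_bigr (fun i => c ^+ 2 * a i ^+ 2)); last first.
  by move=> i _; rewrite exprMn.
by rewrite -big_distrr/= sqrtrM ?sqr_ge0// sqrtr_sqr ger0_norm.
Qed.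

Lemma l2sum_cst (c : R) n : 0 <= c -> l2sum (fun=> c) n <= n%:R * c.
Proof.
move=> c0; elim: n => [|n IH]; first by rewrite /l2sum big_geq// sqrtr0 mul0r.
rewrite l2sumS -(@ger0_norm _ (n.+1%:R * c)) ?mulr_ge0// -sqrtr_sqr.
rewrite ler_wsqrtr// mulrSr mulrDl mul1r sqrrD.
rewrite lerD2r (@le_trans _ _ ((n%:R * c) ^+ 2))//.
  by rewrite ler_sqr ?nnegrE ?l2sum_ge0// mulr_ge0.
by rewrite lerDl mulrn_wge0// mulr_ge0// mulr_ge0.
Qed.

End Ell2Sum.

Section Ell2.
Context {R : realType} {s : scalars}.
Local Notation K := (scalar_field R s).
Implicit Types x y : nat -> K.

Definition square_summable : {pred nat -> K} :=
  fun x => `[< cvgn (series (fun i => nrm (x i) ^+ 2)) >].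

Let series_l2sum x n :
  series (fun i => nrm (x i) ^+ 2) n = l2sum (fun i => nrm (x i)) n ^+ 2.
Proof. by rewrite sqr_l2sum. Qed.

Let series_nd x : nondecreasing_seq (series (fun i => nrm (x i) ^+ 2)).
Proof. by apply: nondecreasing_series => i _; rewrite sqr_ge0. Qed.

Lemma square_summableP x : x \in square_summable <->
  exists2 M : R, 0 <= M & forall n, l2sum (fun i => nrm (x i)) n <= M.
Proof.
rewrite unfold_in; split=> [/asboolP xc|[M M0 xM]]; last first.
  apply/asboolP/nondecreasing_is_cvgn => //.
  exists (M ^+ 2) => _ [n _ <-]; rewrite series_l2sum.
  by rewrite ler_sqr ?nnegrE ?l2sum_ge0.
set S := limn (series (fun i => nrm (x i) ^+ 2)).
exists (Num.sqrt S) => [|n]; first exact: sqrtr_ge0.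
rewrite -(@ger0_norm _ (l2sum _ _)) ?l2sum_ge0// -sqrtr_sqr ler_wsqrtr//.
by rewrite -series_l2sum; exact: nondecreasing_cvgn_le.
Qed.

Let l2sum_lincomb (c : K) x y n :
  l2sum (fun i => nrm (c * x i + y i)) n <=
  nrm c * l2sum (fun i => nrm (x i)) n + l2sum (fun i => nrm (y i)) n.
Proof.
rewrite -l2sumZ ?nrm_ge0//; apply: le_trans (l2sumD _ _ _).
by apply: ler_l2sum => i _; rewrite ger0_norm ?nrm_ge0// -nrmM nrmD.
Qed.

Lemma square_summable_submod : submod_closed square_summable.
Proof.
split=> [|c x y].
  apply/square_summableP; exists 0 => // n; rewrite /l2sum big1 ?sqrtr0//.
  by move=> i _; rewrite nrm0 expr0n.
move=> /square_summableP[M M0 xM] /square_summableP[N N0 yN].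
apply/square_summableP; exists (nrm c * M + N).
  by rewrite addr_ge0// mulr_ge0// nrm_ge0.
move=> n; apply: le_trans (l2sum_lincomb _ _ _ _) _.
by rewrite lerD// ler_wpM2l// nrm_ge0.
Qed.
HB.instance Definition _ := GRing.isSubmodClosed.Build K (nat -> K)
  square_summable square_summable_submod.

End Ell2.

Record ell2 (R : realType) (s : scalars) := Ell2 {
  ell2_val :> nat -> scalar_field R s;
  _ : ell2_val \in square_summable }.

Section Ell2Banach.
Context {R : realType} {s : scalars}.
Local Notation K := (scalar_field R s).
Local Notation H := (ell2 R s).
Implicit Types x y : H.

HB.instance Definition _ := [isSub for @ell2_val R s].
HB.instance Definition _ := [Choice of H by <:].
HB.instance Definition _ := [SubChoice_isSubLmodule of H by <:].

Definition ell2_norm x : R :=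
  Num.sqrt (limn (series (fun i => nrm (ell2_val x i) ^+ 2))).

Lemma ell2_norm_ge0 x : 0 <= ell2_norm x.
Proof. exact: sqrtr_ge0. Qed.

Let cvg_ell2 x : cvgn (series (fun i => nrm (ell2_val x i) ^+ 2)).
Proof. by have := valP x; rewrite unfold_in => /asboolP. Qed.

Lemma l2sum_le_norm x n : l2sum (fun i => nrm (ell2_val x i)) n <= ell2_norm x.
Proof.
rewrite -(@ger0_norm _ (l2sum _ _)) ?l2sum_ge0// -sqrtr_sqr ler_wsqrtr//.
rewrite sqr_l2sum; apply: (nondecreasing_cvgn_le _ (@cvg_ell2 x)).
by apply: nondecreasing_series => i _; rewrite sqr_ge0.
Qed.

Lemma ell2_norm_le x (M : R) : 0 <= M ->
  (forall n, l2sum (fun i => nrm (ell2_val x i)) n <= M) -> ell2_norm x <= M.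
Proof.
move=> M0 xM; rewrite -(@ger0_norm _ M)// -sqrtr_sqr ler_wsqrtr//.
apply: limr_le; first exact: cvg_ell2.
apply: nearW => n; rewrite -[leLHS]sqr_l2sum.
by rewrite ler_sqr ?nnegrE ?l2sum_ge0.
Qed.

Lemma nrm_coord_le x i : nrm (ell2_val x i) <= ell2_norm x.
Proof.
apply: le_trans (l2sum_le_norm x i.+1); rewrite l2sumS.
rewrite -{1}(@ger0_norm _ (nrm _)) ?nrm_ge0// -sqrtr_sqr ler_wsqrtr//.
by rewrite lerDr sqr_ge0.
Qed.

Let normD x y : ell2_norm (x + y) <= ell2_norm x + ell2_norm y.
Proof.
apply: ell2_norm_le => [|n]; first by rewrite addr_ge0// ell2_norm_ge0.
apply: (@le_trans _ _ (l2sum (fun i => nrm (ell2_val x i) + nrm (ell2_val y i)) n)).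
  by apply: ler_l2sum => i _; rewrite ger0_norm ?nrm_ge0// nrmD.
by apply: le_trans (l2sumD _ _ _) _; rewrite lerD// l2sum_le_norm.
Qed.

Let normZle (c : K) x : ell2_norm (c *: x) <= nrm c * ell2_norm x.
Proof.
apply: ell2_norm_le => [|n]; first by rewrite mulr_ge0 ?nrm_ge0// ell2_norm_ge0.
rewrite (_ : l2sum _ _ = nrm c * l2sum (fun i => nrm (ell2_val x i)) n).
  by rewrite ler_wpM2l ?nrm_ge0// l2sum_le_norm.
rewrite -l2sumZ ?nrm_ge0//; congr l2sum; apply/funext => i.
by rewrite -nrmM.
Qed.

Let normZ (c : K) x : ell2_norm (c *: x) = nrm c * ell2_norm x.
Proof.
apply/eqP; rewrite eq_le normZle/=.
have [->|c0] := eqVneq c 0; first by rewrite nrm0 mul0r ell2_norm_ge0.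
rewrite -{1}(scalerK c0 x) (le_trans (ler_wpM2l (nrm_ge0 c) (normZle _ _)))//.
rewrite mulrA -nrmM divff// (_ : nrm 1 = 1) ?mul1r//.
by rewrite -(@ofR1 R s) nrm_ofR.
Qed.

Let norm (x : H) : K := ofR (ell2_norm x).
Let KnormD x y : norm (x + y) <= norm x + norm y.
Proof. by rewrite /norm -ofRD ofR_le. Qed.
Let KnormZ c x : norm (c *: x) = `|c| * norm x.
Proof. by rewrite /norm normZ ofRM ofR_nrm. Qed.
Let Knorm0_eq0 x : norm x = 0 -> x = 0.
Proof.
move=> /(congr1 re); rewrite ofRK -ofR0 ofRK => x0; apply/val_inj/funext => i.
by apply/nrm0_eq0/eqP; rewrite eq_le nrm_ge0 andbT -x0 nrm_coord_le.
Qed.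

HB.instance Definition _ := Lmodule_isNormed.Build K H KnormD KnormZ Knorm0_eq0.

Lemma nrm_ell2 x : nrm x = ell2_norm x.
Proof. by apply: (can_inj (@ofRK R s)); rewrite ofR_nrm. Qed.

Lemma ell2_complete (F : set_system H) : ProperFilter F -> cauchy F -> cvg F.
Proof.
move=> FF /cauchyP Fc.
have {}Fc (e : R) : 0 < e -> exists x, F [set y | nrm (y - x) < e].
  move=> e0; have [|x] := Fc (ofR e); first by rewrite -ofR0 ofR_lt.
  rewrite ball_ofR => Fx; exists x; apply: filterS Fx => y /=.
  by rewrite nrmB.
have coordP i : exists l : K,
    forall e : R, 0 < e -> F [set y | nrm (ell2_val y i - l) < e].
  have [|l Fl] := @scalar_complete R s ((fun y => ell2_val y i) @ F) _.
    move=> e /Fc[x Fx]; exists (ell2_val x i).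
    suff : F [set y | nrm (ell2_val y i - ell2_val x i) < e] by [].
    apply: filterS Fx => y; apply: le_lt_trans.
    by rewrite nrm_ell2 (nrm_coord_le (y - x)).
  by exists l.
have [l Fl] := choice coordP.
have near_l n (d : R) : 0 < d ->
    F [set y | forall i, (i < n)%N -> nrm (ell2_val y i - l i) < d].
  move=> d0; elim: n => [|n IH]; first exact: filterE.
  apply: filterS2 IH (Fl n d d0) => y /= yn yd i.
  by rewrite ltnS leq_eqVlt => /predU1P[->//|]; exact: yn.
have lx (e : R) x : 0 < e -> F [set y | nrm (y - x) < e] ->
    forall n, l2sum (fun i => nrm (l i - ell2_val x i)) n <= e.
  move=> e0 Fx n; apply/ler_addgt0Pr => d d0.
  have d1 : 0 < d / n.+1%:R by rewrite divr_gt0.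
  have [y [/= yx yl]] := filter_ex (filterI Fx (near_l n _ d1)).
  apply: (@le_trans _ _ (l2sum (fun i =>
      nrm (ell2_val (y - x) i) + nrm (ell2_val y i - l i)) n)).
    apply: ler_l2sum => i _; rewrite ger0_norm ?nrm_ge0//.
    rewrite -(nrmN (ell2_val y i - l i)).
    rewrite (_ : l i - ell2_val x i =
      ell2_val (y - x) i + - (ell2_val y i - l i)) ?nrmD//.
    rewrite opprB [RHS]addrC.
    by rewrite -[ell2_val (y - x) i]/(ell2_val y i - ell2_val x i) subrKA.
  apply: le_trans (l2sumD _ _ _) _; rewrite lerD//.
    by rewrite (le_trans (l2sum_le_norm _ _))// -nrm_ell2 ltW.
  apply: (@le_trans _ _ (l2sum (fun=> d / n.+1%:R) n)).
    by apply: ler_l2sum => i /yl/ltW; rewrite ger0_norm ?nrm_ge0.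
  apply: le_trans (l2sum_cst _ (ltW d1)) _.
  by rewrite mulrCA ler_piMr ?ltW// ltr_pdivrMr// mul1r ltr_nat.
have l2 : l \in square_summable.
  have [x Fx] := Fc 1 ltr01.
  rewrite (_ : l = (fun i => l i - ell2_val x i) + ell2_val x); last first.
    by apply/funext => i; rewrite fctE subrK.
  rewrite rpredD ?(valP x)//; apply/square_summableP; exists 1 => //.
  exact: lx Fx.
apply/cvg_ex; exists (Ell2 l2); apply/cvgrPdist_lt => _ /gt0_ofR[e e0 ->].
have e20 : 0 < e / 2 by rewrite divr_gt0.
have [x Fx] := Fc _ e20; apply: filterS (Fx) => y /= yx.
have lxe : nrm (Ell2 l2 - x) <= e / 2.
  rewrite nrm_ell2; apply: ell2_norm_le; first exact: ltW.
  exact: (lx _ x e20 Fx).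
rewrite nrmB in yx.
rewrite -ofR_nrm ofR_lt -(subrKA x) (le_lt_trans (nrmD _ _))// [ltRHS]splitr.
exact: ler_ltD lxe yx.
Qed.

HB.instance Definition _ := Uniform_isComplete.Build H ell2_complete.

End Ell2Banach.

(* Main.v *)
Require Import Defs.
From HB Require Import structures.
From mathcomp Require Import all_boot all_order all_algebra.
From mathcomp Require Import complex ring lra zify.
From mathcomp Require Import boolp classical_sets functions reals.
From mathcomp Require Import topology normedtype sequences.

Set Implicit Arguments.
Unset Strict Implicit.
Unset Printing Implicit Defensive.

(** On [l2 (x) l2] a tensor norm is unitarily invariant, so on the diagonal
    tensors [sum_t x_t e_t (x) e_t] it is a symmetric sequence norm. The proof
    produces a symmetric norm under which the diagonal contains a copy [Y] of
    Hilbert space with no infinite-dimensional subspace complemented in the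
    whole space.

    The norm, [level_norm], is the supremum of the bilinear forms
    [sum_i weight l_i * phi_i x * psi_i y], where both families of functionals
    satisfy Bessel's inequality and the levels [l_i] satisfy
    [sum_i cost l_i <= 1]. Bessel's inequality survives composition with
    contractions, so that for any such supremum the axioms of a tensor norm are
    formal ([form_tensor_norm]); definiteness is the exception, since it rests on
    the Hahn-Banach theorem ([separating_functional], [tensor_separated]).

    Because the matrices [phi_i e_t * psi_i e_t] are doubly substochastic in
    modulus, Young's inequality [weight l * |x_t| <= cost l + G_t] for all [l]
    gives the modular bound [1 + sum_t G_t] for the norm of a diagonal tensor
    ([diag_tensor_norm_le]). The weights and costs are chosen so that a flat
    block [e_(n,k)] of level [k], with suitable length and height, has Young
    function close to [2^-k (t - 2^-k)_+], with an error that is a small multiple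
    of [t^2] ([weight_height_le]). As [t^2] is comparable to
    [sum_k 2^-k (t - 2^-k)_+], the vectors [y_n = sum_k e_(n,k)] span a Hilbert
    space ([hilbert_vec_le], [coef_norm_le]).

    Each level alone, however, is much smaller than Hilbert space: the Young
    function of level [k] is negligible for [t <= 2^-k]. Cut [sum_n a_n y_n] into
    the part where [2^k |a_n| <= 2^I] and the rest. For normalized coefficients
    the rest has norm [O(2^-I)] ([high_norm_le]), while for disjoint normalized
    blocks the sum of [J] low parts has norm [o(sqrt J)], whatever the signs
    ([low_norm_small]).

    Suppose that [P] is a bounded projection onto an infinite-dimensional
    subspace [Z] of [Y]. A gliding hump yields disjoint blocks close to elements
    of [Z]. For [I] large, [P] maps their low parts to vectors of [Z] bounded
    away from zero. Since [Z] is Hilbertian, the parallelogram identity provides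
    signs for which the sum of [J] of these images has norm at least [c sqrt J];
    but it is at most the norm of [P] times [o(sqrt J)]
    ([no_complemented_subspace]). *)

Import Order.TTheory GRing.Theory Num.Theory.
Import numFieldNormedType.Exports.

Local Open Scope classical_set_scope.
Local Open Scope ring_scope.

Section LinearFunctions.
Context {K : nzRingType} {X V : lmodType K} (f : X -> V) (fl : linear f).

Lemma linD x y : f (x + y) = f x + f y.
Proof. by have := fl 1 x y; rewrite !scale1r. Qed.

Lemma lin0 : f 0 = 0.
Proof. by apply: (addrI (f 0)); rewrite -linD !addr0. Qed.

Lemma linZ a x : f (a *: x) = a *: f x.
Proof. by have := fl a x 0; rewrite lin0 !addr0. Qed.

Lemma linN x : f (- x) = - f x.
Proof. by rewrite -scaleN1r linZ scaleN1r. Qed.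

Lemma linB x y : f (x - y) = f x - f y.
Proof. by rewrite linD linN. Qed.

Lemma lin_sum I (r : seq I) (P : pred I) (F : I -> X) :
  f (\sum_(i <- r | P i) F i) = \sum_(i <- r | P i) f (F i).
Proof. exact: (big_morph f linD lin0). Qed.

End LinearFunctions.

(** * Separation of points by continuous functionals *)

Section Sublinear.
Context {R : realType} {s : scalars}.
Local Notation K := (scalar_field R s).
Context {X : lmodType K}.
Implicit Types (p q : X -> R) (x y : X).

Definition sublinear q :=
  (forall x y, q (x + y) <= q x + q y) /\
  (forall (c : R) x, 0 < c -> q (ofR c *: x) <= c * q x).

Lemma sublinearZ q c x : sublinear q -> 0 <= c -> q (ofR c *: x) = c * q x.
Proof.
move=> [_ qZ]; have qZ' (d : R) z : 0 < d -> q (ofR d *: z) = d * q z.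
  move=> d0; apply/eqP; rewrite eq_le qZ//=.
  have := qZ d^-1 (ofR d *: z); rewrite invr_gt0 => /(_ d0).
  rewrite scalerA -ofRM mulVf ?gt_eqF// ofR1 scale1r.
  by rewrite mulrC ler_pdivlMr// mulrC.
rewrite le_eqVlt => /predU1P[<-|]; last exact: qZ'.
rewrite ofR0 scale0r mul0r.
have := qZ' 2 0 (ltr0Sn _ 1); rewrite scaler0; lra.
Qed.

Lemma sublinear0 q : sublinear q -> q 0 = 0.
Proof. by move=> /(@sublinearZ q 0 0) /(_ (lexx _)); rewrite scaler0 mul0r. Qed.

Lemma sublinearN q x : sublinear q -> - q (- x) <= q x.
Proof.
by move=> qs; have := qs.1 x (- x); rewrite subrr sublinear0// -subr_ge0; lra.
Qed.

(** The directional lowering of [q] along [y]: it lies below [q], takes a value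
    at most [- q y] at [- y], and is still sublinear. Comparing a minimal
    sublinear functional with its lowerings is what makes it additive. *)
Definition lowering q y x : R :=
  inf [set q (x + ofR t *: y) - t * q y | t in [set t : R | 0 <= t]].

Lemma lowering_le q y x t : sublinear q -> 0 <= t ->
  lowering q y x <= q (x + ofR t *: y) - t * q y.
Proof.
move=> qs t0; apply: ge_inf; last by exists t.
exists (- q (- x)) => _ [u /= u0 <-]; rewrite -sublinearZ//.
by have := qs.1 (x + ofR u *: y) (- x); rewrite addrAC subrr add0r; lra.
Qed.

Lemma le_lowering q y x m :
  (forall t, 0 <= t -> m <= q (x + ofR t *: y) - t * q y) -> m <= lowering q y x.
Proof.
move=> qm; apply: lb_le_inf; first by exists (q (x + ofR 0 *: y) - 0 * q y), 0 => /=.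
by move=> _ [t t0 <-]; exact: qm.
Qed.

Lemma lowering_sublinear q y : sublinear q -> sublinear (lowering q y).
Proof.
move=> qs; split=> [x x'|c x c0].
  rewrite -lerBlDr; apply: le_lowering => t t0.
  rewrite lerBlDr -lerBlDl; apply: le_lowering => u u0.
  rewrite lerBlDl; have := lowering_le y (x + x') qs (addr_ge0 t0 u0).
  move=> /le_trans; apply; rewrite ofRD scalerDl addrACA.
  by have := qs.1 (x + ofR t *: y) (x' + ofR u *: y); lra.
rewrite mulrC -ler_pdivrMr//; apply: le_lowering => t t0; rewrite ler_pdivrMr//.
apply: (le_trans (lowering_le y _ qs (mulr_ge0 (ltW c0) t0))).
rewrite ofRM -scalerA -scalerDr sublinearZ ?(ltW c0)//; lra.
Qed.

Lemma lowering_le_id q y x : sublinear q -> lowering q y x <= q x.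
Proof.
move=> qs; have := lowering_le y x qs (lexx 0).
by rewrite ofR0 scale0r addr0 mul0r subr0.
Qed.

(** Zorn's lemma: the infimum of a chain of sublinear functionals below [p] is
    bounded below by [- p (- x)], hence finite, and is again sublinear. *)
Lemma minimal_sublinear p : sublinear p -> exists q,
  [/\ sublinear q, forall x, q x <= p x &
      forall q', sublinear q' -> (forall x, q' x <= q x) -> q' = q].
Proof.
move=> ps; pose T := {q : X -> R | sublinear q /\ forall x, q x <= p x}.
pose B : rel T := fun u v : T => `[< forall x, sval v x <= sval u x >].
suff [u umin] : exists u, forall v, B u v -> v = u.
  case: u umin => q [qs qp] qmin.
  exists q; split=> // q' q's q'q.
  have q'p x : q' x <= p x by exact: le_trans (q'q x) (qp x).
  have /(_ (introT (asboolP _) q'q)) := qmin (exist _ q' (conj q's q'p)).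
  by move=> /(congr1 sval).
apply: Zorn.
- by move=> q; apply/asboolP.
- move=> q1 q2 q3 /asboolP q21 /asboolP q32; apply/asboolP => x.
  exact: le_trans (q32 x) (q21 x).
- move=> [q1 Q1] [q2 Q2] /asboolP /= q21 /asboolP /= q12; apply: eq_exist.
  by apply/funext => x; apply/eqP; rewrite eq_le q21 q12.
- move=> A Atot; have [A0|/set0P[q0 Aq0]] := eqVneq A set0.
    by exists (exist _ p (conj ps (fun x => lexx _))) => q; rewrite A0.
  pose g x := inf [set sval u x | u in A].
  have gle (q : T) x : A q -> g x <= sval q x.
    move=> Aq; apply: ge_inf; last by exists q.
    exists (- p (- x)) => _ [[q' [q's q'p]] Aq' <-] /=.
    by have := sublinearN x q's; have := q'p (- x); lra.
  have leg x m : (forall q : T, A q -> m <= sval q x) -> m <= g x.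
    move=> mq; apply: lb_le_inf; first by exists (sval q0 x), q0.
    by move=> _ [q Aq <-]; exact: mq.
  have gs : sublinear g.
    split=> [x y|c x c0]; last first.
      rewrite mulrC -ler_pdivrMr//; apply: (leg) => q Aq; rewrite ler_pdivrMr//.
      apply: le_trans (gle q _ Aq) _; rewrite mulrC.
      by case: q Aq => q [qs qp] Aq /=; rewrite sublinearZ// ltW.
    rewrite -lerBlDr; apply: (leg) => q Aq; rewrite lerBlDr -lerBlDl.
    apply: (leg) => q' Aq'; rewrite lerBlDl.
    have sub (r : T) : A r -> g (x + y) <= sval r x + sval r y.
      move=> Ar; apply: le_trans (gle r _ Ar) _; exact: (svalP r).1.1.
    have [/asboolP qq'|/asboolP qq'] := Atot _ _ Aq Aq'.
      by apply: le_trans (sub _ Aq') _; rewrite lerD2r.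
    by apply: le_trans (sub _ Aq) _; rewrite lerD2l.
  have gp x : g x <= p x.
    by apply: le_trans (gle q0 x Aq0) _; exact: (svalP q0).2.
  exists (exist _ g (conj gs gp)) => q Aq; apply/asboolP => x /=; exact: (gle).
Qed.

(** Minimality forces [lowering q y = q], which for [t = 1] reads
    [q x + q y <= q (x + y)]. *)
Lemma minimal_sublinear_additive q : sublinear q ->
    (forall q', sublinear q' -> (forall x, q' x <= q x) -> q' = q) ->
  forall x y, q (x + y) = q x + q y.
Proof.
move=> qs qmin x y; apply/eqP; rewrite eq_le qs.1/=.
have low : lowering q y = q.
  by apply: qmin => [|z]; [exact: lowering_sublinear|exact: lowering_le_id].
have := lowering_le y x qs ler01; rewrite low ofR1 scale1r mul1r; lra.
Qed.

End Sublinear.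

Section HahnBanach.
Context {R : realType} {s : scalars}.
Local Notation K := (scalar_field R s).

(** Minimizing below the lowering of the norm along [x], rather than below the
    norm itself, pins the value [- nrm x] at [- x]. *)
Lemma real_functional (X : normedModType K) (x : X) : exists f : X -> R,
  [/\ forall y z, f (y + z) = f y + f z, forall (c : R) y, f (ofR c *: y) = c * f y,
      forall y, f y <= nrm y & f x = nrm x].
Proof.
have ns : sublinear (@nrm R s X).
  split=> [|c y c0]; first exact: nrmD.
  by rewrite nrmZ nrm_ofR// ltW.
have [q [qs qp qmin]] := minimal_sublinear (lowering_sublinear x ns).
have qD := minimal_sublinear_additive qs qmin.
have qN y : q (- y) = - q y.
  by have := qD y (- y); rewrite subrr sublinear0//; lra.
have qn y : q y <= nrm y by exact: le_trans (qp y) (lowering_le_id x y ns).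
exists q; split=> //.
  move=> c y; have [c0|c0] := leP 0 c; first exact: sublinearZ.
  have -> : ofR c *: y = - (ofR (- c) *: y).
    apply/eqP; rewrite -subr_eq0 opprK -scalerDl -ofRD subrr ofR0 scale0r//.
  by rewrite qN sublinearZ ?oppr_ge0 1?ltW// mulNr opprK.
apply/eqP; rewrite eq_le qn/=.
have := le_trans (qp (- x)) (lowering_le x (- x) ns ler01).
by rewrite ofR1 scale1r addNr nrm0 qN; lra.
Qed.

(** A substitute for conjugation that makes sense over both scalar fields. *)
Lemma nrm_rotation (k : K) : exists2 c : K, c * k = ofR (nrm k ^+ 2) & nrm c = nrm k.
Proof.
have [->|k0] := eqVneq k 0; first by exists 0; rewrite ?nrm0// expr0n/= ofR0 mulr0.
have nk0 : nrm k != 0 by apply: contra_neq k0; exact: nrm0_eq0.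
exists (ofR (nrm k ^+ 2) / k); first by rewrite divfK.
apply: (mulIf nk0); rewrite -nrmM divfK// nrm_ofR ?sqr_ge0//.
Qed.

(** Over the complex field a real functional [f] is turned into
    [f y - i f (i y)]; rotating [y] shows that its modulus obeys the same bound
    as [f]. *)
Lemma separating_functional (X : normedModType K) (x : X) : x != 0 ->
  exists phi : X -> K^o, [/\ linear phi, forall y, nrm (phi y) <= nrm y & phi x != 0].
Proof.
move=> x0; have [f [fD fZ fn fx]] := real_functional x.
have {x0}fx0 : f x != 0 by rewrite fx; apply: contra_neq x0; exact: nrm0_eq0.
suff [phi [phil phi_re phif]] : exists phi : X -> K^o,
    [/\ linear phi, forall y, re (phi y) = f y & phi x != 0].
  exists phi; split=> // y; have [c cy nc] := nrm_rotation (phi y).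
  have [->|ny0] := eqVneq (nrm (phi y)) 0; first exact: nrm_ge0.
  have ny_gt0 : 0 < nrm (phi y) by rewrite lt_neqAle eq_sym ny0 nrm_ge0.
  have : f (c *: y) <= nrm (c *: y) by exact: fn.
  rewrite -phi_re linZ// (_ : c *: phi y = c * phi y)// cy ofRK nrmZ nc expr2.
  by rewrite ler_pM2l.
move: X x f fD fZ fn fx fx0; rewrite /ofR/re/nrm/=; case: s => X x f fD fZ fn fx fx0.
  by exists f; split=> // a u v; rewrite fD fZ.
pose phi (y : X) : R[i] := Complex (f y) (- f ('i%C *: y)).
exists phi; split=> //; last first.
  by apply: contra_neq fx0 => /(congr1 (@complex.Re R)).
move=> [a b] u v; rewrite /phi.
have e1 (y : X) : Complex a b *: y = real_complex R a *: y + real_complex R b *: ('i%C *: y).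
  rewrite scalerA -scalerDl; congr (_ *: _).
  by apply/eqP; rewrite eq_complex/=; apply/andP; split; apply/eqP; ring.
have e2 (y : X) : 'i%C *: (Complex a b *: y) =
    real_complex R a *: ('i%C *: y) + real_complex R (- b) *: y.
  rewrite !scalerA -scalerDl; congr (_ *: _).
  by apply/eqP; rewrite eq_complex/=; apply/andP; split; apply/eqP; ring.
rewrite scalerDr !fD e2 e1 !fD !fZ.
by apply/eqP; rewrite eq_complex/=; apply/andP; split; apply/eqP; ring.
Qed.

End HahnBanach.

(** * Tensor norms given by classes of bilinear forms *)

Section BilinearForms.
Context {K : comNzRingType} {X Y V : lmodType K}.

Definition bilinear_map (f : X -> Y -> V) :=
  (forall y, linear (f^~ y)) /\ (forall x, linear (f x)).

Context (f : X -> Y -> V) (fb : bilinear_map f).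

Lemma lift_linear : linear (tensor_lift f).
Proof. by apply: tensor_lift_linear; [exact: fb.1|exact: fb.2]. Qed.

Lemma lift_tens x y : tensor_lift f (tens x y) = f x y.
Proof. by apply: tensor_lift_tens; [exact: fb.1|exact: fb.2]. Qed.

Lemma lift_sum I (r : seq I) (P : pred I) (u : I -> X) (v : I -> Y) :
  tensor_lift f (\sum_(i <- r | P i) tens (u i) (v i)) =
  \sum_(i <- r | P i) f (u i) (v i).
Proof.
by rewrite (lin_sum lift_linear); apply: eq_bigr => i _; exact: lift_tens.
Qed.

End BilinearForms.

Lemma tens_bilinear (K : comNzRingType) (X Y : lmodType K) :
  bilinear_map (@tens K X Y).
Proof. by split; [exact: tens_linearl|exact: tens_linearr]. Qed.

Lemma bilinear_comp (K : comNzRingType) (X Y X0 Y0 V : lmodType K)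
    (f : X0 -> Y0 -> V) (T : X -> X0) (S : Y -> Y0) :
  bilinear_map f -> linear T -> linear S ->
  bilinear_map (fun x y => f (T x) (S y)).
Proof.
move=> [fl fr] Tl Sl; split=> [y a u v|x a u v] /=.
  by rewrite Tl fl.
by rewrite Sl fr.
Qed.

Lemma bilinear_prod (K : comNzRingType) (X Y : lmodType K)
    (phi : X -> K^o) (psi : Y -> K^o) : linear phi -> linear psi ->
  bilinear_map (fun x y => phi x * psi y : K^o).
Proof.
move=> phil psil; split=> [y a u v|x a u v] /=.
  by rewrite phil mulrDl -scalerAl.
by rewrite psil mulrDr -scalerAr.
Qed.

Lemma bilinear_sum (K : comNzRingType) (X Y V : lmodType K) I (r : seq I)
    (f : I -> X -> Y -> V) : (forall i, bilinear_map (f i)) ->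
  bilinear_map (fun x y => \sum_(i <- r) f i x y).
Proof.
move=> fb; split=> [y a u v|x a u v].
  by rewrite scaler_sumr -big_split; apply: eq_bigr => i _; exact: (fb i).1.
by rewrite scaler_sumr -big_split; apply: eq_bigr => i _; exact: (fb i).2.
Qed.

Lemma bilinearZ (K : comNzRingType) (X Y V : lmodType K) (c : K)
    (f : X -> Y -> V) : bilinear_map f -> bilinear_map (fun x y => c *: f x y).
Proof.
move=> [fl fr]; split=> [y a u v|x a u v].
  by rewrite fl scalerDr !scalerA mulrC.
by rewrite fr scalerDr !scalerA mulrC.
Qed.

Section TensorBounds.
Context {R : realType} {s : scalars}.
Local Notation K := (scalar_field R s).

Lemma lift_tensor_map (X Y X0 Y0 V : lmodType K) (f : X0 -> Y0 -> V)
    (T : X -> X0) (S : Y -> Y0) a :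
  bilinear_map f -> linear T -> linear S ->
  tensor_lift f (tensor_map T S a) = tensor_lift (fun x y => f (T x) (S y)) a.
Proof.
move=> fb Tl Sl; have [l ->] := tensorP a.
have tb := bilinear_comp (@tens_bilinear _ _ _) Tl Sl.
have cb := bilinear_comp fb Tl Sl.
by rewrite /tensor_map (lift_sum tb) (lift_sum fb) (lift_sum cb).
Qed.

Lemma nrm_sum (V : normedModType K) I (r : seq I) (F : I -> V) :
  nrm (\sum_(i <- r) F i) <= \sum_(i <- r) nrm (F i).
Proof.
elim/big_rec2: _ => [|i y1 y2 _ yle]; first by rewrite nrm0.
by apply: le_trans (nrmD _ _) _; rewrite lerD2l.
Qed.

(** By induction on the number of terms: if [phi x != 0] and every product
    functional kills [x (x) y + sum_p p.1 (x) p.2], then [y] is a combination of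
    the [p.2], so that the sum can be rewritten with one term less. *)
Lemma tensor_separated (X Y : normedModType K) (a : tensor X Y) :
  (forall (phi : X -> K^o) (psi : Y -> K^o), linear phi -> linear psi ->
     (forall x, nrm (phi x) <= nrm x) -> (forall y, nrm (psi y) <= nrm y) ->
     tensor_lift (fun x y => phi x * psi y : K^o) a = 0) -> a = 0.
Proof.
have [l ->] := tensorP a => h.
have {h} : forall (phi : X -> K^o) (psi : Y -> K^o), linear phi -> linear psi ->
     (forall x, nrm (phi x) <= nrm x) -> (forall y, nrm (psi y) <= nrm y) ->
     \sum_(p <- l) phi p.1 * psi p.2 = 0.
  move=> phi psi phil psil phi1 psi1.
  by rewrite -[RHS](h phi psi phil psil phi1 psi1) (lift_sum (bilinear_prod phil psil)).
have [n] := ubnP (size l); elim: n l => // n IH [|[x y] l] ln h.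
  by rewrite big_nil.
rewrite big_cons /=.
have [x0|/separating_functional[phi0 [phi0l phi01 phi0x]]] := eqVneq x 0.
  rewrite x0 (lin0 (tens_linearl y)) add0r; apply: IH => // phi psi phil psil phi1 psi1.
  by have := h phi psi phil psil phi1 psi1; rewrite big_cons /= x0 lin0// mul0r add0r.
pose c (p : X * Y) : K := phi0 p.1 / phi0 x.
have yE : y = - \sum_(p <- l) c p *: p.2.
  apply/eqP; rewrite -addr_eq0; apply/negPn/negP => /separating_functional[psi [psil psi1]].
  rewrite linD// (lin_sum psil).
  have := h phi0 psi phi0l psil phi01 psi1; rewrite big_cons /=.
  move/(congr1 ( *%R (phi0 x)^-1)); rewrite mulrDr mulr0 mulKf// mulr_sumr => e.
  case/eqP; rewrite -[RHS]e; congr (_ + _); apply: eq_bigr => p _.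
  by rewrite linZ// mulrA [_^-1 * _]mulrC.
have -> : tens x y + \sum_(p <- l) tens p.1 p.2 =
    \sum_(p <- [seq (p.1 - c p *: x, p.2) | p <- l]) tens p.1 p.2.
  rewrite big_map yE (linN (tens_linearr x)) (lin_sum (tens_linearr x)) addrC -sumrB.
  apply: eq_bigr => p _ /=.
  by rewrite (linB (tens_linearl p.2)) tensZl (linZ (tens_linearr x)).
apply: IH => [|phi psi phil psil phi1 psi1]; first by rewrite size_map.
rewrite -[RHS](h phi psi phil psil phi1 psi1) big_map big_cons /=.
rewrite yE linN// (lin_sum psil) mulrN mulr_sumr addrC -sumrB.
apply: eq_bigr => p _; rewrite linB// mulrBl (linZ phil) (linZ psil).
have scaleK (u v : K) : u *: (v : K^o) = u * v by [].
by rewrite !scaleK; congr (_ - _); rewrite mulrCA mulrA.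
Qed.

End TensorBounds.

Section OperatorNorm.
Context {R : realType} {s : scalars}.
Local Notation K := (scalar_field R s).

Lemma continuous_bounded (X Y : normedModType K) (T : X -> Y) : linear T ->
  continuous T -> exists2 C : R, 0 < C & forall x, nrm (T x) <= C * nrm x.
Proof.
move=> Tl /(_ 0); rewrite /continuous_at (lin0 Tl) => T0.
have /T0 : nbhs (0 : Y) [set y | nrm y < 1].
  apply/nbhs_ballP; exists (ofR 1) => /=; first by rewrite -ofR0 ofR_lt.
  by rewrite ball_ofR => y /=; rewrite sub0r nrmN.
rewrite /= => /nbhs_ballP[_ /gt0_ofR[d d0 ->]]; rewrite ball_ofR => dT.
have d20 : 0 < d / 2 by rewrite divr_gt0.
exists (d / 2)^-1 => [|x]; first by rewrite invr_gt0.
have [->|x0] := eqVneq x 0; first by rewrite lin0// !nrm0 mulr0.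
have nx0 : 0 < nrm x.
  by rewrite lt_neqAle nrm_ge0 andbT eq_sym; apply: contra_neq x0; exact: nrm0_eq0.
have c0 : 0 < d / 2 / nrm x by rewrite divr_gt0.
have : nrm (T (ofR (d / 2 / nrm x) *: x)) < 1.
  apply: dT => /=; rewrite sub0r nrmN nrmZ nrm_ofR ?(ltW c0)// divfK ?gt_eqF//; lra.
rewrite linZ// nrmZ nrm_ofR ?(ltW c0)// => /ltW.
rewrite -ler_pdivlMl// mulr1 => /le_trans; apply.
by rewrite invf_div mulrC.
Qed.

Lemma nrm_le_opnorm (X Y : normedModType K) (T : X -> Y) x : linear T ->
  continuous T -> nrm (T x) <= opnorm T * nrm x.
Proof.
move=> Tl /(continuous_bounded Tl)[C C0 TC].
have [->|x0] := eqVneq x 0; first by rewrite lin0// !nrm0 mulr0.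
have nx0 : 0 < nrm x.
  by rewrite lt_neqAle nrm_ge0 andbT eq_sym; apply: contra_neq x0; exact: nrm0_eq0.
have nxV0 : 0 <= (nrm x)^-1 by rewrite invr_ge0 nrm_ge0.
rewrite -ler_pdivrMr//; apply: ub_le_sup.
  exists C => _ [y /= y1 <-]; apply: le_trans (TC _) _.
  by rewrite ler_piMr// ltW.
exists (ofR (nrm x)^-1 *: x) => /=; first by rewrite nrmZ nrm_ofR// mulVf ?gt_eqF.
by rewrite linZ// nrmZ nrm_ofR// mulrC.
Qed.

Lemma opnorm_ge0 (X Y : normedModType K) (T : X -> Y) : linear T ->
  continuous T -> 0 <= opnorm T.
Proof.
move=> Tl /(continuous_bounded Tl)[C C0 TC]; rewrite -(nrm0 Y) -(lin0 Tl).
apply: ub_le_sup; last by exists 0; rewrite /= ?nrm0.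
by exists C => _ [y /= y1 <-]; rewrite (le_trans (TC _))// ler_piMr// ltW.
Qed.

End OperatorNorm.

(** What a family of bilinear forms has to satisfy for its supremum to be a tensor
    norm: boundedness by one gives the projective upper bound, the products of
    functionals give the injective lower bound, and stability under contractions
    gives the metric mapping property. *)
Record form_class (R : realType) (s : scalars) := FormClass {
  forms :> forall X Y : completeNormedModType (scalar_field R s),
    set (X -> Y -> (scalar_field R s)^o);
  form_bilinear : forall X Y f, @forms X Y f -> bilinear_map f;
  form_bounded : forall X Y f x y, @forms X Y f -> nrm (f x y) <= nrm x * nrm y;
  form_prod : forall (X Y : completeNormedModType (scalar_field R s))
      (phi : X -> (scalar_field R s)^o) (psi : Y -> (scalar_field R s)^o),
    linear phi -> linear psi ->
    (forall x, nrm (phi x) <= nrm x) -> (forall y, nrm (psi y) <= nrm y) ->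
    @forms X Y (fun x y => phi x * psi y);
  form_comp : forall (X X0 Y Y0 : completeNormedModType (scalar_field R s))
      (T : X -> X0) (S : Y -> Y0) f, linear T -> linear S ->
    (forall x, nrm (T x) <= nrm x) -> (forall y, nrm (S y) <= nrm y) ->
    @forms X0 Y0 f -> @forms X Y (fun x y => f (T x) (S y)) }.

Arguments forms {R s} f0 X Y _.

Section FormNorm.
Context {R : realType} {s : scalars} (Phi : form_class R s).
Local Notation K := (scalar_field R s).
Implicit Types X Y : completeNormedModType K.

Definition form_norm X Y (a : tensor X Y) : R :=
  sup [set nrm (tensor_lift f a) | f in Phi X Y].

Lemma lift_le_sum X Y f (l : seq (X * Y)) : Phi X Y f ->
  nrm (tensor_lift f (\sum_(p <- l) tens p.1 p.2)) <=
  \sum_(p <- l) nrm p.1 * nrm p.2.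
Proof.
move=> Phif; rewrite (lift_sum (form_bilinear Phif)).
apply: le_trans (nrm_sum _ _) _; apply: ler_sum => p _.
exact: form_bounded Phif.
Qed.

Lemma lift_le_form_norm X Y f (a : tensor X Y) : Phi X Y f ->
  nrm (tensor_lift f a) <= form_norm a.
Proof.
move=> Phif; apply: ub_le_sup; last by exists f.
have [l ->] := tensorP a; exists (\sum_(p <- l) nrm p.1 * nrm p.2) => _ [g Phig <-].
exact: lift_le_sum.
Qed.

Lemma form_nonempty X Y : exists f, Phi X Y f.
Proof.
exists (fun x y => (0 : K^o) * (0 : K^o) : K^o).
have l0 (V : lmodType K) : linear (fun _ : V => 0 : K^o).
  by move=> a u v; rewrite scaler0 addr0.
apply: (form_prod Phi (phi := fun=> 0) (psi := fun=> 0)) => [||x|y].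
- exact: l0.
- exact: l0.
- by rewrite nrm0 nrm_ge0.
- by rewrite nrm0 nrm_ge0.
Qed.

Lemma form_norm_le X Y (a : tensor X Y) m :
  (forall f, Phi X Y f -> nrm (tensor_lift f a) <= m) -> form_norm a <= m.
Proof.
move=> am; have [f Phif] := form_nonempty X Y.
apply: ge_sup; first by exists (nrm (tensor_lift f a)), f.
by move=> _ [g Phig <-]; exact: am.
Qed.

Lemma form_norm_ge0 X Y (a : tensor X Y) : 0 <= form_norm a.
Proof.
have [f Phif] := form_nonempty X Y.
exact: le_trans (nrm_ge0 _) (lift_le_form_norm a Phif).
Qed.

Lemma form_normD X Y (a b : tensor X Y) :
  form_norm (a + b) <= form_norm a + form_norm b.
Proof.
apply: form_norm_le => f Phif; have fl := lift_linear (form_bilinear Phif).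
by rewrite linD// (le_trans (nrmD _ _))// lerD// lift_le_form_norm.
Qed.

Lemma form_normZ X Y c (a : tensor X Y) :
  form_norm (c *: a) = nrm c * form_norm a.
Proof.
have Zle d (b : tensor X Y) : form_norm (d *: b) <= nrm d * form_norm b.
  apply: form_norm_le => f Phif; have fl := lift_linear (form_bilinear Phif).
  by rewrite linZ// nrmZ ler_wpM2l ?nrm_ge0// lift_le_form_norm.
apply/eqP; rewrite eq_le Zle/=.
have [->|c0] := eqVneq c 0; first by rewrite nrm0 mul0r form_norm_ge0.
rewrite -{1}(scalerK c0 a) (le_trans (ler_wpM2l (nrm_ge0 c) (Zle _ _)))//.
by rewrite mulrA -nrmM divff// -(@ofR1 R s) nrm_ofR// mul1r.
Qed.

Lemma form_norm0_eq0 X Y (a : tensor X Y) : form_norm a = 0 -> a = 0.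
Proof.
move=> a0; apply: tensor_separated => phi psi phil psil phi1 psi1.
apply: nrm0_eq0; apply/eqP; rewrite eq_le nrm_ge0 andbT -a0.
exact/lift_le_form_norm/form_prod.
Qed.

Lemma injective_le_form_norm X Y (a : tensor X Y) : injective_norm a <= form_norm a.
Proof.
have dual (V : normedModType K) (phi : {linear V -> K^o}) v :
    dual_ball phi -> nrm (phi v) <= nrm v.
  move=> [phic phi1]; apply: le_trans (nrm_le_opnorm v (linearP phi) phic) _.
  by rewrite ler_piMl ?nrm_ge0.
rewrite /injective_norm; set A := [set r | _].
have [->|/set0P A0] := eqVneq A set0; first by rewrite sup0 form_norm_ge0.
apply: ge_sup => // _ [phi [psi [phi1 psi1 ->]]].
apply: lift_le_form_norm; apply: form_prod => [||x|y]; [exact: linearP..| |]; exact: dual.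
Qed.

Lemma form_norm_le_projective X Y (a : tensor X Y) : form_norm a <= projective_norm a.
Proof.
apply: lb_le_inf => [|_ [l al ->]].
  by have [l al] := tensorP a; exists (\sum_(p <- l) nrm p.1 * nrm p.2), l.
by apply: form_norm_le => f Phif; rewrite al; exact: lift_le_sum.
Qed.

Lemma form_norm_map X X0 Y Y0 (T : {linear X -> X0}) (S : {linear Y -> Y0})
    (a : tensor X Y) : continuous T -> continuous S ->
  form_norm (tensor_map T S a) <= opnorm T * opnorm S * form_norm a.
Proof.
move=> Tc Sc; have Tl : linear T := linearP T; have Sl : linear S := linearP S.
have T0 := opnorm_ge0 Tl Tc; have S0 := opnorm_ge0 Sl Sc.
apply: form_norm_le => f Phif; have fb := form_bilinear Phif.
rewrite lift_tensor_map//.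
(* Outside the degenerate case, the operators are normalized to contractions. *)
have [TS0|] := eqVneq (opnorm T * opnorm S) 0.
  rewrite TS0 mul0r (_ : tensor_lift _ _ = 0) ?nrm0//.
  have [l ->] := tensorP a; rewrite (lift_sum (bilinear_comp fb Tl Sl)).
  apply: big1_seq => p _; move/eqP: TS0; rewrite mulf_eq0 => /orP[]/eqP op0.
    have /nrm0_eq0 -> : nrm (T p.1) = 0; last by rewrite (lin0 (fb.1 _)).
    apply/eqP; rewrite eq_le nrm_ge0 andbT.
    by apply: le_trans (nrm_le_opnorm _ Tl Tc) _; rewrite op0 mul0r.
  have /nrm0_eq0 -> : nrm (S p.2) = 0; last by rewrite (lin0 (fb.2 _)).
  apply/eqP; rewrite eq_le nrm_ge0 andbT.
  by apply: le_trans (nrm_le_opnorm _ Sl Sc) _; rewrite op0 mul0r.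
rewrite mulf_eq0 negb_or => /andP[Tn0 Sn0].
pose t : K := ofR (opnorm T); pose u : K := ofR (opnorm S).
have t0 : t != 0 by apply: contra_neq Tn0 => /(congr1 re); rewrite ofRK -ofR0 ofRK.
have u0 : u != 0 by apply: contra_neq Sn0 => /(congr1 re); rewrite ofRK -ofR0 ofRK.
have scaled (V W : normedModType K) (U : V -> W) : linear U -> linear (fun v => (ofR (opnorm U))^-1 *: U v).
  by move=> Ul b v w; rewrite Ul scalerDr !scalerA mulrC.
have contr (V W : normedModType K) (U : V -> W) v : linear U -> continuous U ->
    opnorm U != 0 -> nrm ((ofR (opnorm U))^-1 *: U v) <= nrm v.
  move=> Ul Uc U0; have UK : (ofR (opnorm U) : K) != 0.
    by apply: contra_neq U0 => /(congr1 re); rewrite ofRK -ofR0 ofRK.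
  have Up : 0 < opnorm U by rewrite lt_neqAle eq_sym U0 opnorm_ge0.
  rewrite -(ler_pM2l Up) -{1}(nrm_ofR (s := s) (ltW Up)) -nrmZ scalerA divff// scale1r.
  exact: nrm_le_opnorm.
pose g x y := f (t^-1 *: T x) (u^-1 *: S y).
have Phig : Phi X Y g.
  apply: (form_comp (T := fun x => t^-1 *: T x) (S := fun y => u^-1 *: S y)) => //.
  - exact: scaled.
  - exact: scaled.
  - by move=> x; exact: contr.
  - by move=> x; exact: contr.
have -> : tensor_lift (fun x y => f (T x) (S y)) a = (t * u) *: tensor_lift g a.
  have [l ->] := tensorP a.
  rewrite (lift_sum (bilinear_comp fb Tl Sl)) (lift_sum (form_bilinear Phig)).
  rewrite scaler_sumr; apply: eq_bigr => p _; rewrite /g.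
  by rewrite (linZ (fb.1 _)) (linZ (fb.2 _)) !scalerA mulrACA !divff// mulr1 scale1r.
rewrite nrmZ nrmM !nrm_ofR// ler_wpM2l ?mulr_ge0//.
exact: lift_le_form_norm.
Qed.

Definition form_tensor_norm : tensor_norm R s :=
  TensorNorm form_normD form_normZ form_norm0_eq0 injective_le_form_norm
    form_norm_le_projective form_norm_map.

End FormNorm.

(** * The completion of a normed space *)

Section CompletionTheory.
Context {R : realType} {s : scalars}.
Local Notation K := (scalar_field R s).

Lemma nrm_dist_triangle (V : normedModType K) (x y z : V) :
  nrm (x - z) <= nrm (x - y) + nrm (y - z).
Proof. by apply: le_trans (nrmD _ _); rewrite addrA subrK. Qed.

Lemma nrm_small_eq0 (V : normedModType K) (x : V) (C : R) :
  (forall d, 0 < d -> nrm x <= C * d) -> x = 0.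
Proof.
move=> xC; apply/nrm0_eq0/eqP; rewrite eq_le nrm_ge0 andbT.
apply/ler_addgt0Pr => e e0; rewrite add0r.
have C0 : 0 < `|C| + 1 by rewrite ltr_wpDl.
apply: le_trans (xC (e / (`|C| + 1)) (divr_gt0 e0 C0)) _.
rewrite mulrCA -[leRHS]mulr1 ler_pM2l// ler_pdivrMr// mul1r.
by rewrite (le_trans (ler_norm _))// lerDl.
Qed.

Lemma cauchy_filterP (V : normedModType K) (F : set_system V) : ProperFilter F ->
  cauchy F -> forall e : R, 0 < e -> exists x, F [set y | nrm (y - x) < e].
Proof.
move=> FF /cauchyP Fc e e0; have [|x] := Fc (ofR e); first by rewrite -ofR0 ofR_lt.
by rewrite ball_ofR => Fx; exists x; apply: filterS Fx => y /=; rewrite nrmB.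
Qed.

Context (V : normedModType K).
Local Notation embed := (@completion_embed R s V).
Local Notation lim_pt u := (quotmod_pi (@is_null R s V) u : completion V).

Lemma completion_seq_lim (u : cauchy_seq V) (e : R) : 0 < e ->
  exists N, forall n, (N <= n)%N -> nrm (lim_pt u - embed (u n)) <= e.
Proof.
move=> e0; have /cauchy_seqP /(_ e e0)[N uN] := cauchy_valP u.
exists N => n nN; rewrite nrm_completion -quotmod_piB completion_norm_pi.
apply: limr_le; first exact/cvg_nrm_cauchy/cauchy_valP.
by exists N => // m /= mN; exact/ltW/uN.
Qed.

Lemma completion_banach : is_banach (completion V).
Proof.
move=> F FF /(cauchy_filterP FF) Fc.
have /choice[v Fv] (n : nat) :
    exists v : V, F [set y | nrm (y - embed v) < n.+1%:R^-1].
  have e0 : 0 < (n.+1%:R^-1 : R) / 2 by rewrite divr_gt0// invr_gt0.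
  have [x Fx] := Fc _ e0; have [v xv] := completion_embed_dense x e0.
  exists v; apply: filterS Fx => y /= yx.
  by rewrite (le_lt_trans (nrm_dist_triangle _ x _))// [ltRHS]splitr ltrD.
have vdist m n : nrm (v m - v n) < m.+1%:R^-1 + n.+1%:R^-1.
  have [y [/= ym yn]] := filter_ex (filterI (Fv m) (Fv n)).
  rewrite -nrm_completion_embed (linB (@completion_embed_linear _ _ V)).
  by rewrite (le_lt_trans (nrm_dist_triangle _ y _))// ltrD// nrmB.
have small (e : R) : 0 < e -> exists N, forall n, (N <= n)%N -> n.+1%:R^-1 < e.
  move=> e0; exists (Num.truncn e^-1) => n nN.
  rewrite invf_plt ?posrE// (lt_le_trans (truncnS_gt _))//.
  by rewrite ler_nat.
have vc : (v : nat -> V) \in @is_cauchy R s V.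
  apply/asboolP/cauchy_seqP => e e0.
  have [N Ne] := small (e / 2) (divr_gt0 e0 (ltr0Sn _ 1)).
  exists N => m n mN nN; rewrite (lt_trans (vdist m n))// [ltRHS]splitr.
  by rewrite ltrD// Ne.
apply/cvg_ex; exists (lim_pt (CauchySeq vc)).
apply/cvgrPdist_lt => _ /gt0_ofR[e e0 ->].
have e20 : 0 < e / 2 by rewrite divr_gt0.
have [N1 Ne1] := small _ e20; have [N2 Ne2] := completion_seq_lim (CauchySeq vc) e20.
pose n := maxn N1 N2; apply: filterS (Fv n) => y /= yn.
rewrite -ofR_nrm ofR_lt (le_lt_trans (nrm_dist_triangle _ (embed (v n)) _))//.
rewrite [ltRHS]splitr ler_ltD//; first by rewrite Ne2// leq_maxr.
by rewrite nrmB (lt_trans yn)// Ne1// leq_maxl.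
Qed.

(** The value at [q] is the only scalar [l] with
    [nrm (f v - l) <= nrm (embed v - q)] for all [v]; linearity and the norm bound
    follow from this characterization by density. *)
Lemma functional_extension (f : V -> K^o) : linear f ->
    (forall v, nrm (f v) <= nrm v) ->
  exists g : completion V -> K^o, [/\ linear g, forall q, nrm (g q) <= nrm q &
    forall v, g (embed v) = f v].
Proof.
move=> fl f1.
have eD := linD (@completion_embed_linear _ _ V).
have eZ := linZ (@completion_embed_linear _ _ V).
have eB := linB (@completion_embed_linear _ _ V).
have /choice[g gP] (q : completion V) :
    exists l : K^o, forall v, nrm (f v - l) <= nrm (embed v - q).
  pose u : cauchy_seq V := repr q.
  have qu (e : R) : 0 < e -> exists N, forall n, (N <= n)%N -> nrm (q - embed (u n)) <= e.
    by move=> /(completion_seq_lim u); rewrite quotmod_piK.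
  have [|l ul] := @scalar_complete R s ((fun n => f (u n)) @ \oo) _.
    move=> e e0; have /cauchy_seqP /(_ e e0)[N uN] := cauchy_valP u.
    exists (f (u N)); exists N => // n /= nN.
    by rewrite -linB// (le_lt_trans (f1 _))// uN.
  exists l => v; apply/ler_addgt0Pr => e e0.
  have e20 : 0 < e / 2 by rewrite divr_gt0.
  have [N uN] := qu _ e20; have [M _ uM] := ul _ e20.
  pose n := maxn N M; have /ltW fn : nrm (f (u n) - l) < e / 2 by apply: uM; exact: leq_maxr.
  have un : nrm (q - embed (u n)) <= e / 2 by apply: uN; exact: leq_maxl.
  apply: le_trans (nrm_dist_triangle _ (f (u n)) _) _.
  rewrite [in leRHS](splitr e) addrA lerD// -linB// (le_trans (f1 _))//.
  rewrite -nrm_completion_embed eB (le_trans (nrm_dist_triangle _ q _))//.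
  by rewrite lerD2l.
have gE v : g (embed v) = f v.
  apply/esym/eqP; rewrite -subr_eq0; apply/eqP/nrm0_eq0/eqP.
  by rewrite eq_le nrm_ge0 andbT (le_trans (gP _ _))// subrr nrm0.
exists g; split=> // [a q q'|q].
  apply/eqP; rewrite -subr_eq0; apply/eqP.
  apply: (@nrm_small_eq0 _ _ ((nrm a + 1) * 2)) => d d0.
  have [v qv] := completion_embed_dense q d0.
  have [v' qv'] := completion_embed_dense q' d0.
  have fv : nrm (f v - g q) <= d by rewrite (le_trans (gP _ _))// nrmB ltW.
  have fv' : nrm (f v' - g q') <= d by rewrite (le_trans (gP _ _))// nrmB ltW.
  have fvv : nrm (g (a *: q + q') - f (a *: v + v')) <= nrm a * d + d.
    rewrite nrmB (le_trans (gP _ _))// eD eZ opprD addrACA -scalerBr.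
    apply: le_trans (nrmD _ _) _; rewrite nrmZ lerD ?ler_wpM2l ?nrm_ge0//.
      by rewrite nrmB ltW.
    by rewrite nrmB ltW.
  apply: le_trans (nrm_dist_triangle _ (f (a *: v + v')) _) _.
  rewrite (_ : (nrm a + 1) * 2 * d = (nrm a * d + d) + (nrm a * d + d)); last by ring.
  rewrite lerD// fl opprD addrACA -scalerBr (le_trans (nrmD _ _))// nrmZ lerD//.
  by rewrite ler_wpM2l ?nrm_ge0.
apply/ler_addgt0Pr => e e0; have e20 : 0 < e / 2 by rewrite divr_gt0.
have [v qv] := completion_embed_dense q e20.
have fv : nrm (g q - f v) <= e / 2 by rewrite nrmB (le_trans (gP _ _))// nrmB ltW.
have fvq : nrm (f v) <= nrm q + e / 2.
  rewrite (le_trans (f1 _))// -nrm_completion_embed -[embed v](subrK q).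
  by rewrite (le_trans (nrmD _ _))// addrC lerD2l nrmB ltW.
have gv : nrm (g q) <= nrm (g q - f v) + nrm (f v) by rewrite -[in leLHS](subrK (f v) (g q)) nrmD.
lra.
Qed.

End CompletionTheory.

(** * The symmetric norm: levels, weights and costs *)

Lemma sum_Cauchy_Schwarz (R : realFieldType) I (r : seq I) (a b : I -> R) A B :
  0 <= A -> 0 <= B ->
  \sum_(i <- r) a i ^+ 2 <= A ^+ 2 -> \sum_(i <- r) b i ^+ 2 <= B ^+ 2 ->
  \sum_(i <- r) a i * b i <= A * B.
Proof.
move=> A0 B0 aA bB; set S := \sum_(i <- r) _ * _.
have S2 t u : 2 * t * u * S <= t ^+ 2 * A ^+ 2 + u ^+ 2 * B ^+ 2.
  have : 0 <= \sum_(i <- r) (t * a i - u * b i) ^+ 2.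
    by apply: sumr_ge0 => i _; rewrite sqr_ge0.
  rewrite (eq_bigr (fun i => t ^+ 2 * a i ^+ 2 + u ^+ 2 * b i ^+ 2 - 2 * t * u * (a i * b i))); last first.
    by move=> i _; ring.
  rewrite sumrB big_split -!mulr_sumr -/S /= subr_ge0 => /le_trans; apply.
  by rewrite lerD// ler_wpM2l ?sqr_ge0.
have [AE|A1] := eqVneq A 0.
  have := S2 (B ^+ 2 + 1) S; rewrite AE expr0n/= mulr0 add0r mul0r => h.
  have := sqr_ge0 S; have := sqr_ge0 B; nra.
have [BE|B1] := eqVneq B 0.
  have := S2 S (A ^+ 2 + 1); rewrite BE expr0n/= mulr0 addr0 mulr0 => h.
  have := sqr_ge0 S; have := sqr_ge0 A; nra.
have AB : 0 < A * B by rewrite mulr_gt0// lt_neqAle eq_sym ?A1 ?B1.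
rewrite -(ler_pM2l AB); have := S2 B A; lra.
Qed.

Section Levels.
Context {R : realType}.
Implicit Types (k l n L : nat) (t : R).

Definition hpow n : R := 2^-1 ^+ n.

Lemma hpow_gt0 n : 0 < hpow n.
Proof. by rewrite exprn_gt0// invr_gt0. Qed.

Lemma hpow_ge0 n : 0 <= hpow n.
Proof. exact/ltW/hpow_gt0. Qed.

Lemma hpowD m n : hpow (m + n) = hpow m * hpow n.
Proof. exact: exprD. Qed.

Lemma le_hpow m n : (m <= n)%N -> hpow n <= hpow m.
Proof. by move=> mn; rewrite /hpow ler_wiXn2l//; lra. Qed.

Lemma hpow_le1 n : hpow n <= 1.
Proof. exact: (@le_hpow 0). Qed.

Lemma hpow_natr n : (2 ^ n)%:R * hpow n = 1.
Proof. by rewrite /hpow exprVn natrX mulfV ?expf_neq0 ?pnatr_eq0. Qed.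

(** The growth is fast enough for consecutive levels not to interact:
    [growth k - growth l >= 2 * k] for [l < k] makes [weight * multiplicity]
    increase and [weight ^ 2 * multiplicity] decrease rapidly with the level. *)
Definition growth k : nat := (k * k + k)%N.
Definition multiplicity k : nat := (2 ^ (4 * growth k))%N.
Definition weight l : R := hpow (3 * growth l).
Definition cost l : R := hpow (2 * l + 4 * growth l).
Definition height k : R := hpow (k + growth k).

(** An upper bound for the Young function of a flat block of level [k]. The
    parameter [L] trades the size of the quadratic error for the range of [t] in
    which the bound is valid. *)
Definition young L k t : R :=
  (if hpow k < t then hpow k * t else 0) + hpow (2 * L + 2 * k) * t ^+ 2.

Lemma multiplicityE k : (multiplicity k)%:R * hpow (4 * growth k) = 1.
Proof. exact: hpow_natr. Qed.

Lemma young_ge0 L k t : 0 <= t -> 0 <= young L k t.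
Proof.
move=> t0; rewrite addr_ge0// ?mulr_ge0 ?sqr_ge0 ?hpow_ge0//.
by case: ifP => // _; rewrite mulr_ge0 ?hpow_ge0.
Qed.

(** Lower levels are too expensive for [t <= 2^k], the level [k] itself gives the
    linear term, and a higher level gives the quadratic term by the inequality of
    arithmetic and geometric means, unless it is below [L], where it is too
    expensive as well. *)
Lemma weight_height_le l k L t : 0 <= t -> hpow k * t <= 1 ->
  (0 < L)%N ==> (t <= hpow (growth L + 2 * L)) ->
  weight l * height k * t <= cost l + hpow (4 * growth k) * young L k t.
Proof.
move=> t0 tk tL; have y0 := young_ge0 L k t0.
have cheap : weight l * height k * t <= cost l ->
    weight l * height k * t <= cost l + hpow (4 * growth k) * young L k t.
  by move=> /le_trans; apply; rewrite lerDl mulr_ge0// hpow_ge0.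
have [lk|kl|->] := ltngtP l k.
- apply: cheap; rewrite /weight /height hpowD (mulrC (hpow k)) !mulrA -mulrA.
  apply: (@le_trans _ _ (hpow (3 * growth l) * hpow (growth k))).
    by rewrite ler_piMr// mulr_ge0 ?hpow_ge0.
  by rewrite -hpowD; apply: le_hpow; rewrite /growth; nia.
- have [Ll|lL] := leqP L l; last first.
    apply: cheap; have {}tL : t <= hpow (growth L + 2 * L).
      by move: tL; rewrite (leq_ltn_trans _ lL).
    apply: le_trans (ler_wpM2l _ tL) _; first by rewrite mulr_ge0 ?hpow_ge0.
    by rewrite -!hpowD; apply: le_hpow; rewrite /growth; nia.
  pose c : R := cost l; pose E : R := hpow (4 * growth k) * hpow (2 * L + 2 * k).
  have AE : (weight l * height k) ^+ 2 <= c * E.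
    rewrite expr2 /c /E -!hpowD; apply: le_hpow; rewrite /growth; nia.
  have c0 : 0 <= c by exact: hpow_ge0.
  have E0 : 0 <= E by rewrite mulr_ge0 ?hpow_ge0.
  apply: (@le_trans _ _ (c + E * t ^+ 2)).
    rewrite -ler_sqr ?nnegrE ?addr_ge0 ?mulr_ge0 ?hpow_ge0 ?sqr_ge0//.
    rewrite exprMn; have := ler_wpM2r (sqr_ge0 t) AE => /le_trans; apply.
    have := sqr_ge0 (c - E * t ^+ 2).
    have : 0 <= c * E * t ^+ 2 by apply: mulr_ge0; [exact: mulr_ge0|exact: sqr_ge0].
    nra.
  rewrite lerD2l /E -mulrA ler_wpM2l ?hpow_ge0// lerDr.
  by case: ifP => // _; rewrite mulr_ge0 ?hpow_ge0.
- rewrite /young; case: ltP => [kt|tk'].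
    apply: ler_wpDl; first exact: hpow_ge0.
    rewrite mulrDr; apply: ler_wpDr; first by rewrite !mulr_ge0 ?hpow_ge0 ?sqr_ge0.
    rewrite mulrA ler_wpM2r// -!hpowD; apply: le_hpow; lia.
  rewrite add0r; apply: ler_wpDr; first by rewrite !mulr_ge0 ?hpow_ge0 ?sqr_ge0.
  apply: le_trans (ler_wpM2l _ tk') _; first by rewrite mulr_ge0 ?hpow_ge0.
  rewrite -!hpowD; apply: le_hpow; lia.
Qed.

End Levels.

Section LevelForms.
Context {R : realType} {s : scalars}.
Local Notation K := (scalar_field R s).

Definition bessel (X : normedModType K) r (phi : nat -> X -> K^o) :=
  (forall i, linear (phi i)) /\
  (forall x, \sum_(i < r) nrm (phi i x) ^+ 2 <= nrm x ^+ 2).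

Definition level_form (X Y : completeNormedModType K) : set (X -> Y -> K^o) :=
  [set f | exists r (l : nat -> nat) (phi : nat -> X -> K^o) (psi : nat -> Y -> K^o),
     [/\ bessel r phi, bessel r psi, \sum_(i < r) cost (l i) <= 1 :> R &
         f = fun x y => \sum_(i < r) ofR (weight (l i)) *: (phi i x * psi i y : K^o)]].

Lemma level_form_bilinear (X Y : completeNormedModType K) f :
  level_form f -> bilinear_map (f : X -> Y -> K^o).
Proof.
move=> [r [l [phi [psi [phib psib _ ->]]]]]; apply: bilinear_sum => i.
by apply: bilinearZ; apply: bilinear_prod; [exact: phib.1|exact: psib.1].
Qed.

Lemma level_form_bounded (X Y : completeNormedModType K) (f : X -> Y -> K^o) x y :
  level_form f -> nrm (f x y) <= nrm x * nrm y.
Proof.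
move=> [r [l [phi [psi [phib psib _ ->]]]]].
apply: le_trans (nrm_sum _ _) _.
apply: (@le_trans _ _ (\sum_(i < r) nrm (phi i x) * nrm (psi i y))).
  apply: ler_sum => i _; rewrite nrmZ nrmM nrm_ofR ?hpow_ge0// ler_piMl ?hpow_le1//.
  by rewrite mulr_ge0 ?nrm_ge0.
apply: sum_Cauchy_Schwarz; rewrite ?nrm_ge0//; [exact: phib.2|exact: psib.2].
Qed.

Lemma level_form_prod (X Y : completeNormedModType K)
    (phi : X -> K^o) (psi : Y -> K^o) : linear phi -> linear psi ->
  (forall x, nrm (phi x) <= nrm x) -> (forall y, nrm (psi y) <= nrm y) ->
  level_form (fun x y => phi x * psi y).
Proof.
move=> phil psil phi1 psi1.
exists 1%N, (fun=> 0%N), (fun=> phi), (fun=> psi); split.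
- by split=> // x; rewrite big_ord1 ler_sqr ?nnegrE ?nrm_ge0.
- by split=> // x; rewrite big_ord1 ler_sqr ?nnegrE ?nrm_ge0.
- by rewrite big_ord1 hpow_le1.
- by apply/funext => x; apply/funext => y; rewrite big_ord1 ofR1 scale1r.
Qed.

Lemma level_form_comp (X X0 Y Y0 : completeNormedModType K)
    (T : X -> X0) (S : Y -> Y0) f : linear T -> linear S ->
  (forall x, nrm (T x) <= nrm x) -> (forall y, nrm (S y) <= nrm y) ->
  level_form f -> level_form (fun x y => f (T x) (S y)).
Proof.
move=> Tl Sl T1 S1 [r [l [phi [psi [[phil phib] [psil psib] lc ->]]]]].
exists r, l, (fun i x => phi i (T x)), (fun i y => psi i (S y)); split=> //.
- split=> [i a u v|x]; first by rewrite Tl phil.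
  by rewrite (le_trans (phib _))// ler_sqr ?nnegrE ?nrm_ge0.
- split=> [i a u v|x]; first by rewrite Sl psil.
  by rewrite (le_trans (psib _))// ler_sqr ?nnegrE ?nrm_ge0.
Qed.

Definition level_class : form_class R s :=
  FormClass level_form_bilinear level_form_bounded level_form_prod level_form_comp.

Definition level_norm : tensor_norm R s := form_tensor_norm level_class.

End LevelForms.

(** * Diagonal tensors over the Hilbert space *)

Notation triple := (nat * nat * nat)%type.

Section Diagonal.
Context {R : realType} {s : scalars}.
Local Notation K := (scalar_field R s).
Local Notation H := (ell2 R s).
Implicit Types (t : triple) (P : seq triple).

Lemma sum_pickle_le (a : nat -> R) P : (forall i, 0 <= a i) -> uniq P ->
  exists n, \sum_(t <- P) a (pickle t) <= \sum_(0 <= i < n) a i.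
Proof.
move=> a0 Pu; pose Q := [seq pickle t | t <- P].
have Qu : uniq Q by rewrite map_inj_uniq//; exact: pcan_inj pickleK.
exists (\max_(i <- Q) i.+1)%N.
have -> : \sum_(t <- P) a (pickle t) = \sum_(i <- Q) a i by rewrite big_map.
have pQ : perm_eq [seq i <- index_iota 0 (\max_(i <- Q) i.+1)%N | i \in Q] Q.
  apply: uniq_perm => //; first by rewrite filter_uniq// iota_uniq.
  move=> i; rewrite mem_filter mem_index_iota /=; apply: andb_idr => iQ.
  exact: (@leq_bigmax_seq _ Q xpredT succn).
rewrite -(perm_big _ pQ) big_filter big_mkcond/=; apply: ler_sum => i _; by case: ifP.
Qed.

Lemma ell2_basis_proof t :
  (fun i => (i == pickle t)%:R : K) \in @square_summable R s.
Proof.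
apply/square_summableP; exists 1 => // n.
rewrite -[leRHS]sqrtr1 ler_wsqrtr//.
have [tn|nt] := ltnP (pickle t) n.
  rewrite (bigD1_seq (pickle t)) ?mem_index_iota ?iota_uniq//= eqxx.
  rewrite -(@ofR1 R s) nrm_ofR// expr1n big1 ?addr0// => i /negPf->.
  by rewrite nrm0 expr0n.
rewrite big1_seq// => i /andP[_]; rewrite mem_index_iota /= => it.
by rewrite (ltn_eqF (leq_trans it nt)) nrm0 expr0n.
Qed.

Definition ell2_basis t : H := Ell2 (ell2_basis_proof t).

Lemma ell2_sumE I (r : seq I) (x : I -> H) i :
  ell2_val (\sum_(j <- r) x j) i = \sum_(j <- r) ell2_val (x j) i.
Proof. by elim/big_rec2: _ => // j y1 y2 _ <-. Qed.

Lemma sqr_nrm_le (x : H) (M : R) : 0 <= M ->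
  (forall n, \sum_(0 <= i < n) nrm (ell2_val x i) ^+ 2 <= M) -> nrm x ^+ 2 <= M.
Proof.
move=> M0 xM; rewrite -(sqr_sqrtr M0) ler_sqr ?nnegrE ?nrm_ge0 ?sqrtr_ge0//.
rewrite nrm_ell2; apply: ell2_norm_le => [|n]; first exact: sqrtr_ge0.
exact: ler_wsqrtr.
Qed.

Lemma le_sqr_nrm (x : H) n :
  \sum_(0 <= i < n) nrm (ell2_val x i) ^+ 2 <= nrm x ^+ 2.
Proof.
by rewrite -sqr_l2sum ler_sqr ?nnegrE ?nrm_ge0 ?l2sum_ge0// nrm_ell2 l2sum_le_norm.
Qed.

Lemma sqr_nrm_lincomb P (c : triple -> K) : uniq P ->
  nrm (\sum_(t <- P) c t *: ell2_basis t) ^+ 2 <= \sum_(t <- P) nrm (c t) ^+ 2.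
Proof.
move=> Pu; apply: sqr_nrm_le => [|n].
  by apply: sumr_ge0 => t _; rewrite sqr_ge0.
have coordE i : nrm (ell2_val (\sum_(t <- P) c t *: ell2_basis t) i) ^+ 2 <=
    \sum_(t <- P) nrm (c t) ^+ 2 * (i == pickle t)%:R.
  rewrite ell2_sumE.
  have -> : \sum_(t <- P) ell2_val (c t *: ell2_basis t) i =
      \sum_(t <- P) c t * (i == pickle t)%:R by [].
  have [/hasP[t tP /eqP it]|/hasPn noP] := boolP (has (fun t => i == pickle t) P).
    have it' u : u != t -> (i == pickle u) = false.
      by move=> ut; rewrite it (inj_eq (pcan_inj pickleK)) eq_sym (negPf ut).
    rewrite (bigD1_seq t)//= [leRHS](bigD1_seq t)//= it eqxx !mulr1 -it.
    by rewrite !big1 ?addr0// => u /it' ->; rewrite mulr0.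
  rewrite big1_seq ?nrm0 ?expr0n/=; last first.
    by move=> t tP; rewrite (negPf (noP _ tP)) mulr0.
  by apply: sumr_ge0 => t _; rewrite mulr_ge0 ?sqr_ge0.
apply: le_trans (ler_sum _ (fun i _ => coordE i)) _.
rewrite exchange_big; apply: ler_sum => t _; rewrite -mulr_sumr ler_piMr ?sqr_ge0//.
have [tn|nt] := ltnP (pickle t) n.
  rewrite (bigD1_seq (pickle t)) ?mem_index_iota ?iota_uniq//= eqxx.
  by rewrite big1 ?addr0// => i /negPf->.
rewrite big1_seq// => i /andP[_]; rewrite mem_index_iota /= => it.
by rewrite (ltn_eqF (leq_trans it nt)).
Qed.

Lemma nrm_basis_le t : nrm (ell2_basis t) ^+ 2 <= 1.
Proof.
have := @sqr_nrm_lincomb [:: t] (fun=> 1) isT.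
by rewrite !big_seq1 scale1r -(@ofR1 R s) nrm_ofR// expr1n.
Qed.

(** With [c_t] conjugate to [phi e_t], the vector [sum_t c_t e_t] has square norm
    at most [S] and value [S] under [phi], so that [S ^ 2 <= S]. *)
Lemma functional_row_le (phi : H -> K^o) P : linear phi ->
  (forall x, nrm (phi x) <= nrm x) -> uniq P ->
  \sum_(t <- P) nrm (phi (ell2_basis t)) ^+ 2 <= 1.
Proof.
move=> phil phi1 Pu; set S := \sum_(t <- P) _.
have S0 : 0 <= S by apply: sumr_ge0 => t _; rewrite sqr_ge0.
have /choice[c cP] t : exists c : K, c * phi (ell2_basis t) = ofR (nrm (phi (ell2_basis t)) ^+ 2)
    /\ nrm c = nrm (phi (ell2_basis t)).
  by have [c] := nrm_rotation (phi (ell2_basis t)); exists c.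
have := phi1 (\sum_(t <- P) c t *: ell2_basis t).
have -> : phi (\sum_(t <- P) c t *: ell2_basis t) = ofR S.
  rewrite (lin_sum phil) (big_morph ofR (@ofRD R s) (@ofR0 R s)).
  by apply: eq_bigr => t _; rewrite linZ// -(cP t).1.
rewrite nrm_ofR// => Sn.
have : S ^+ 2 <= S.
  apply: le_trans (_ : nrm (\sum_(t <- P) c t *: ell2_basis t) ^+ 2 <= S).
    by rewrite ler_sqr ?nnegrE ?nrm_ge0.
  apply: le_trans (sqr_nrm_lincomb c Pu) _.
  by apply: ler_sum => t _; rewrite (cP t).2.
nra.
Qed.

Definition diag_tensor P (x : triple -> K) : tensor H H :=
  \sum_(t <- P) x t *: tens (ell2_basis t) (ell2_basis t).

(** The matrices [phi_i(e_t) psi_i(e_t)] are doubly substochastic in modulus,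
    so Young's inequality [weight l * x <= cost l + G] can be averaged. *)
Lemma diag_tensor_norm_le P (x : triple -> K) (G : triple -> R) : uniq P ->
  (forall t, 0 <= G t) ->
  (forall t l, t \in P -> weight l * nrm (x t) <= cost l + G t) ->
  level_norm H H (diag_tensor P x) <= 1 + \sum_(t <- P) G t.
Proof.
move=> Pu G0 Gx; apply: form_norm_le => f Phif.
have fb := form_bilinear Phif; have ll := lift_linear fb.
rewrite (lin_sum ll); case: Phif => r [l [phi [psi [phib psib lc fE]]]].
pose om (i : 'I_r) t : R :=
  (nrm (phi i (ell2_basis t)) ^+ 2 + nrm (psi i (ell2_basis t)) ^+ 2) / 2.
have om0 i t : 0 <= om i t by rewrite divr_ge0 ?addr_ge0 ?sqr_ge0.
have bessel1 (th : nat -> H -> K^o) (i : 'I_r) z : bessel r th -> nrm (th i z) <= nrm z.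
  move=> [_ thb]; rewrite -ler_sqr ?nnegrE ?nrm_ge0// (le_trans _ (thb z))//.
  by rewrite (bigD1 i)//= lerDl sumr_ge0// => j _; rewrite sqr_ge0.
have om_row i : \sum_(t <- P) om i t <= 1.
  rewrite -mulr_suml big_split/= ler_pdivrMr// mul1r -natr1 lerD//.
    by apply: functional_row_le => // [|z]; [exact: phib.1|exact: bessel1].
  by apply: functional_row_le => // [|z]; [exact: psib.1|exact: bessel1].
have om_col t : \sum_(i < r) om i t <= 1.
  rewrite -mulr_suml big_split/= ler_pdivrMr// mul1r -natr1 lerD//.
    exact: le_trans (phib.2 _) (nrm_basis_le t).
  exact: le_trans (psib.2 _) (nrm_basis_le t).
apply: (@le_trans _ _ (\sum_(t <- P) \sum_(i < r) (cost (l i) + G t) * om i t)).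
  apply: le_trans (nrm_sum _ _) _; rewrite [leLHS]big_seq [leRHS]big_seq.
  apply: ler_sum => t tP; rewrite linZ// lift_tens// nrmZ fE mulrC.
  apply: le_trans (ler_wpM2r (nrm_ge0 _) (nrm_sum _ _)) _.
  rewrite mulr_suml; apply: ler_sum => i _.
  rewrite nrmZ nrmM nrm_ofR ?hpow_ge0// mulrAC.
  apply: ler_pM; rewrite ?mulr_ge0 ?hpow_ge0 ?nrm_ge0//; first exact: Gx.
  rewrite /om; set a := nrm _; set b := nrm _.
  have := sqr_ge0 (a - b); nra.
under eq_bigr => t _ do under eq_bigr => i _ do rewrite mulrDl.
under eq_bigr => t _ do rewrite big_split.
rewrite big_split /= lerD//.
  rewrite exchange_big /= (le_trans _ lc)//; apply: ler_sum => i _.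
  by rewrite -mulr_sumr ler_piMr// hpow_ge0.
by apply: ler_sum => t _; rewrite -mulr_sumr ler_piMr.
Qed.

Definition entry t (a : tensor H H) : K^o :=
  tensor_lift (fun x y : H => ell2_val x (pickle t) * ell2_val y (pickle t) : K^o) a.

Lemma coord_linear i : linear (fun x : H => ell2_val x i : K^o).
Proof. by []. Qed.

Lemma entry_linear t : linear (entry t).
Proof. by apply: lift_linear; apply: bilinear_prod; exact: coord_linear. Qed.

Lemma entry_diag_tensor t P (x : triple -> K) : uniq P ->
  entry t (diag_tensor P x) = if t \in P then x t else 0.
Proof.
move=> Pu; rewrite (lin_sum (entry_linear t)).
have E u : entry t (x u *: tens (ell2_basis u) (ell2_basis u)) = x u * (t == u)%:R.
  rewrite (linZ (entry_linear t)) /entry lift_tens; last first.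
    by apply: bilinear_prod; exact: coord_linear.
  rewrite /= (inj_eq (pcan_inj pickleK)).
  rewrite (_ : x u *: _ = x u * ((t == u)%:R * (t == u)%:R))//.
  by case: (t == u); rewrite ?(mulr0, mulr1).
case: ifPn => tP; last first.
  rewrite big1_seq// => u /andP[_ uP]; rewrite E.
  by case: eqP => [tu|_]; [rewrite tu uP in tP|rewrite mulr0].
rewrite (bigD1_seq t)//= E eqxx mulr1 big1 ?addr0// => u ut.
by rewrite E eq_sym (negPf ut) mulr0.
Qed.

(** The lower bound matching [diag_tensor_norm_le]: coordinates are a Bessel family. *)
Lemma entries_le_norm P (l : triple -> nat) (c : triple -> K) (a : tensor H H) :
  uniq P -> (forall t, nrm (c t) <= 1) -> \sum_(t <- P) cost (l t) <= 1 :> R ->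
  nrm (\sum_(t <- P) ofR (weight (l t)) *: (c t *: entry t a)) <= level_norm H H a.
Proof.
move=> Pu c1 lc; pose d : triple := (0, 0, 0)%N; pose t i := nth d P i.
pose phi i (x : H) : K^o := ell2_val x (pickle (t i)).
pose psi i (x : H) : K^o := c (t i) *: phi i x.
have phib : bessel (size P) phi.
  split=> [i|x]; first exact: coord_linear.
  rewrite -(big_mkord xpredT (fun i => nrm (phi i x) ^+ 2)).
  rewrite -(big_nth d xpredT (fun t => nrm (ell2_val x (pickle t)) ^+ 2)).
  have [|n] := @sum_pickle_le (fun i => nrm (ell2_val x i) ^+ 2) P _ Pu.
    by move=> i; rewrite sqr_ge0.
  by move=> /le_trans; apply; exact: le_sqr_nrm.
have psib : bessel (size P) psi.
  split=> [i a' u v|x]; first by rewrite /psi /phi coord_linear scalerDr !scalerA mulrC.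
  apply: le_trans (phib.2 x); apply: ler_sum => i _.
  rewrite ler_sqr ?nnegrE ?nrm_ge0// nrmZ ler_piMl ?nrm_ge0//.
pose f (x y : H) : K^o := \sum_(i < size P) ofR (weight (l (t i))) *: (phi i x * psi i y : K^o).
have Phif : level_class H H f.
  exists (size P), (fun i => l (t i)), phi, psi; split=> //.
  rewrite -(big_mkord xpredT (fun i => cost (l (t i)))).
  by rewrite -(big_nth d xpredT (fun t => cost (l t))).
have -> : \sum_(t <- P) ofR (weight (l t)) *: (c t *: entry t a) = tensor_lift f a.
  have [z ->] := tensorP a.
  rewrite (lift_sum (form_bilinear Phif)).
  under eq_bigr => u _ do rewrite (lin_sum (entry_linear u)) !scaler_sumr.
  rewrite exchange_big; apply: eq_bigr => p _ /=.
  rewrite /f -(big_mkord xpredT (fun i => ofR (weight (l (t i))) *: (phi i p.1 * psi i p.2 : K^o))).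
  rewrite (big_nth d) /=; apply: eq_bigr => i _; congr (_ *: _).
  rewrite /entry lift_tens; last by apply: bilinear_prod; exact: coord_linear.
  by rewrite /psi /phi -scalerAr.
exact: lift_le_form_norm.
Qed.

Lemma entry_le_norm t (a : tensor H H) : nrm (entry t a) <= level_norm H H a.
Proof.
apply: lift_le_form_norm; apply: form_prod; try exact: coord_linear.
  by move=> x; rewrite nrm_ell2 nrm_coord_le.
by move=> x; rewrite nrm_ell2 nrm_coord_le.
Qed.

End Diagonal.

(** * A Hilbertian subspace of diagonal tensors *)

Section GeometricSums.
Context {R : realType}.

Lemma sum_hpow_le2 (m : nat) : \sum_(0 <= k < m) hpow k <= 2 :> R.
Proof.
suff : \sum_(0 <= k < m) hpow k <= 2 - 2 * hpow m :> R.
  by have := @hpow_ge0 R m; lra.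
elim: m => [|m IH]; first by rewrite big_geq// /hpow expr0; lra.
rewrite big_nat_recr//= (le_trans (lerD IH (lexx _)))//.
by rewrite -(addn1 m) hpowD /hpow expr1; lra.
Qed.

(** The terms kept form a geometric progression with largest term below [x]. *)
Lemma sum_hpow_lt (m : nat) (c x : R) : 0 <= c -> 0 <= x ->
  \sum_(0 <= k < m | hpow k * c < x) hpow k * c <= 2 * x.
Proof.
move=> c0 x0; elim: m c c0 => [|m IH] c c0; first by rewrite big_geq// mulr_ge0.
rewrite big_mkcond/= big_nat_recl//= /hpow expr0 mul1r -/(hpow _).
have shiftE : \sum_(0 <= i < m) (if hpow i.+1 * c < x then hpow i.+1 * c else 0) =
    \sum_(0 <= i < m | hpow i * (2^-1 * c) < x) hpow i * (2^-1 * c).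
  rewrite [RHS]big_mkcond; apply: eq_bigr => i _.
  by rewrite (_ : hpow i.+1 * c = hpow i * (2^-1 * c))// /hpow exprSr mulrA.
have c20 : 0 <= 2^-1 * c by lra.
rewrite -[X in _ + X]/(\sum_(0 <= i < m) (if hpow i.+1 * c < x then hpow i.+1 * c else 0)).
rewrite shiftE; case: ifP => [cx|_]; last by rewrite add0r IH.
apply: le_trans (_ : c + \sum_(0 <= i < m) hpow i * (2^-1 * c) <= _).
  rewrite lerD2l big_mkcond; apply: ler_sum => i _; case: ifP => // _.
  by rewrite mulr_ge0 ?hpow_ge0.
rewrite -mulr_suml; have := ler_wpM2r c20 (sum_hpow_le2 m); lra.
Qed.

Lemma hpow_small (e : R) : 0 < e -> exists n, hpow n < e.
Proof.
move=> e0; exists (Num.truncn e^-1).+1.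
have := truncnS_gt e^-1; set n := (Num.truncn _).+1 => en.
have n2 : (n < 2 ^ n)%N by exact: ltn_expl.
have h0 := @hpow_gt0 R n.
have : e^-1 < (2 ^ n)%:R by rewrite (lt_trans en)// ltr_nat.
rewrite -(ltr_pM2r h0) hpow_natr => h.
by rewrite -(ltr_pM2l (_ : 0 < e^-1)) ?invr_gt0// mulVf ?gt_eqF.
Qed.

End GeometricSums.

Section Blocks.
Context {R : realType} {s : scalars}.
Local Notation K := (scalar_field R s).
Local Notation H := (ell2 R s).
Local Notation nu := (level_norm H H).
Implicit Types (a : nat -> K) (v : nat -> nat -> K).

Lemma nuZ (c : K) (x : tensor H H) : nu (c *: x) = nrm c * nu x.
Proof. exact: tnormZ. Qed.

Lemma nuD (x y : tensor H H) : nu (x + y) <= nu x + nu y.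
Proof. exact: tnormD. Qed.

Lemma nu_ge0 (x : tensor H H) : 0 <= nu x.
Proof. exact: form_norm_ge0. Qed.

(** Block [n] has the levels [k <= n + 1] only, which keeps the vectors [y_n] in
    the algebraic tensor product. *)
Definition pairs N : seq (nat * nat) :=
  [seq (n, k) | n <- index_iota 0 N, k <- index_iota 0 n.+2].

Definition blocks N : seq triple :=
  [seq (p, i) | p <- pairs N, i <- index_iota 0 (multiplicity p.2)].

Lemma blocks_uniq N : uniq (blocks N).
Proof.
apply: allpairs_uniq_dep => [|p _|[p i] [q j] _ _ /= [-> ->]]//; last exact: iota_uniq.
apply: allpairs_uniq_dep => [|n _|[p i] [q j] _ _ /= [-> ->]]//; exact: iota_uniq.
Qed.

Lemma sum_blocks (V : nmodType) (F : triple -> V) N : \sum_(t <- blocks N) F t =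
  \sum_(0 <= n < N) \sum_(0 <= k < n.+2) \sum_(0 <= i < multiplicity k) F (n, k, i).
Proof. by rewrite !big_allpairs_dep. Qed.

Lemma mem_blocks N t : (t \in blocks N) =
  [&& (t.1.1 < N)%N, (t.1.2 < t.1.1.+2)%N & (t.2 < multiplicity t.1.2)%N].
Proof.
apply/allpairsPdep/and3P.
  move=> [p [i [/allpairsPdep[n [k [nN kn ->]]] ik ->]]] /=.
  by rewrite !mem_index_iota in nN kn ik.
case: t => [[n k] i] /= [nN kn ik]; exists (n, k), i; split=> //.
  by apply/allpairsPdep; exists n, k; rewrite !mem_index_iota.
by rewrite mem_index_iota.
Qed.

Definition block_vec N v : tensor H H :=
  diag_tensor (blocks N) (fun t => ofR (height t.1.2) * v t.1.1 t.1.2).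

Lemma block_vecD N v w :
  block_vec N (fun n k => v n k + w n k) = block_vec N v + block_vec N w.
Proof.
by rewrite -big_split; apply: eq_bigr => t _; rewrite mulrDr scalerDl.
Qed.

Lemma block_vecZ N c v : block_vec N (fun n k => c * v n k) = c *: block_vec N v.
Proof.
by rewrite scaler_sumr; apply: eq_bigr => t _; rewrite mulrCA scalerA.
Qed.

Lemma eq_block_vec N v w : (forall n k, (n < N)%N -> (k < n.+2)%N -> v n k = w n k) ->
  block_vec N v = block_vec N w.
Proof.
move=> vw; rewrite /block_vec /diag_tensor !big_allpairs_dep.
apply: eq_big_nat => n /andP[_ nN]; apply: eq_big_nat => k /andP[_ kn].
by apply: eq_bigr => i _ /=; rewrite vw.
Qed.

Lemma block_norm_le N L v :
  (forall n k, (n < N)%N -> (k < n.+2)%N -> hpow k * nrm (v n k) <= 1) ->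
  (forall n k, (n < N)%N -> (0 < L)%N ==> (nrm (v n k) <= hpow (growth L + 2 * L))) ->
  nu (block_vec N v) <=
    1 + \sum_(0 <= n < N) \sum_(0 <= k < n.+2) young L k (nrm (v n k)).
Proof.
move=> v1 vL.
pose G (t : triple) : R := hpow (4 * growth t.1.2) * young L t.1.2 (nrm (v t.1.1 t.1.2)).
have -> : \sum_(0 <= n < N) \sum_(0 <= k < n.+2) young L k (nrm (v n k)) =
    \sum_(t <- blocks N) G t.
  rewrite sum_blocks; apply: eq_bigr => n _; apply: eq_bigr => k _.
  rewrite /G /= sumr_const_nat subn0 -mulr_natl mulrA.
  by rewrite multiplicityE mul1r.
apply: diag_tensor_norm_le; first exact: blocks_uniq.
  by move=> t; rewrite mulr_ge0 ?hpow_ge0// young_ge0// nrm_ge0.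
move=> [[n k] i] l; rewrite mem_blocks /= => /and3P[nN kn _].
rewrite nrmM nrm_ofR ?hpow_ge0// mulrA; apply: weight_height_le; rewrite ?nrm_ge0//.
  exact: v1.
exact: vL.
Qed.

(** The cut-off depends on the level relative to the size of the coefficient. *)
Definition low I a n k : K := if nrm (a n) * hpow I <= hpow k then a n else 0.
Definition high I a n k : K := if nrm (a n) * hpow I <= hpow k then 0 else a n.

Definition hilbert_vec N a : tensor H H := block_vec N (fun n _ => a n).

Lemma hilbert_vecE I N a :
  hilbert_vec N a = block_vec N (low I a) + block_vec N (high I a).
Proof.
rewrite -block_vecD; apply: eq_block_vec => n k _ _; rewrite /low /high.
by case: ifP; rewrite ?addr0 ?add0r.
Qed.

Lemma coef_le1 N a n : \sum_(0 <= i < N) nrm (a i) ^+ 2 <= 1 :> R -> (n < N)%N ->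
  nrm (a n) <= 1.
Proof.
move=> a1 nN; rewrite -(@ler_sqr R) ?nnegrE ?nrm_ge0// expr1n (le_trans _ a1)//.
rewrite (bigD1_seq n) ?mem_index_iota ?iota_uniq//= lerDl.
by apply: sumr_ge0 => i _; rewrite sqr_ge0.
Qed.

(** Scaled by [2^I], the high part of [a_n] only meets levels with
    [2^(I - k) < |a_n|], so that its Young functions add up to a multiple of
    [|a_n| ^ 2]. *)
Lemma high_norm_le I N a : \sum_(0 <= n < N) nrm (a n) ^+ 2 <= 1 :> R ->
  nu (block_vec N (high I a)) <= 5 * hpow I.
Proof.
move=> a1; have hI := @hpow_gt0 R I; have hI' : hpow I != 0 :> R by rewrite gt_eqF.
pose c : R := (hpow I)^-1; have c0 : 0 < c by rewrite invr_gt0.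
have cE x : x * hpow I * c = x by rewrite mulfK.
suff : nu (block_vec N (fun n k => ofR c * high I a n k)) <= 5.
  by rewrite block_vecZ nuZ nrm_ofR ?(ltW c0)// mulrC -ler_pdivlMr// invrK.
have highE n k : (n < N)%N -> nrm (ofR c * high I a n k) =
    if hpow k * c < nrm (a n) then c * nrm (a n) else 0.
  move=> nN; rewrite nrmM nrm_ofR ?(ltW c0)// /high.
  rewrite -(ler_pM2r c0) cE leNgt; case: ltP; rewrite ?nrm0 ?mulr0//.
have hkc n k : (n < N)%N -> hpow k * c < nrm (a n) -> hpow k * (c * nrm (a n)) <= 1.
  move=> nN kc; rewrite mulrA; have := coef_le1 a1 nN; have := nrm_ge0 (a n).
  have : 0 <= hpow k * c by rewrite mulr_ge0 ?hpow_ge0 ?ltW.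
  nra.
apply: le_trans (block_norm_le (L := 0) _ _) _ => //.
  move=> n k nN _; rewrite highE//; case: ifP => [|_]; last by rewrite mulr0.
  exact: hkc.
suff : \sum_(0 <= n < N) \sum_(0 <= k < n.+2) young 0 k (nrm (ofR c * high I a n k))
    <= \sum_(0 <= n < N) 4 * nrm (a n) ^+ 2.
  rewrite -mulr_sumr; have := a1; lra.
rewrite big_nat [leRHS]big_nat; apply: ler_sum => n /andP[_ nN].
set x := nrm (a n); have x0 : 0 <= x := nrm_ge0 _; have x1 := coef_le1 a1 nN.
apply: (@le_trans _ _ (2 * x * \sum_(0 <= k < n.+2 | hpow k * c < x) hpow k * c)).
  rewrite mulr_sumr [leRHS]big_mkcond; apply: ler_sum => k _.
  rewrite highE// -/x; case: ifP => [kx|_]; last first.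
    by rewrite /young ltNge hpow_ge0/= expr0n/= mulr0 addr0.
  have kc0 : 0 <= hpow k * c by rewrite mulr_ge0 ?hpow_ge0 ?ltW.
  rewrite /young; apply: (@le_trans _ _ (hpow k * c * x + (hpow k * c * x) * x)); last first.
    have : 0 <= hpow k * c * x by rewrite mulr_ge0.
    rewrite -/x in x1; nra.
  rewrite lerD//; first by rewrite mulrA; case: ifP => // _; exact: mulr_ge0.
  rewrite muln0 add0n mul2n -addnn hpowD.
  rewrite (_ : _ * _ = hpow k * c * x * (hpow k * c * x)); last by ring.
  rewrite ler_wpM2l ?mulr_ge0//; rewrite -/x in x1; nra.
have := ler_wpM2l (_ : 0 <= 2 * x) (sum_hpow_lt n.+2 (ltW c0) x0).
by rewrite mulr_ge0// => /(_ isT); lra.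
Qed.

(** The cut-off makes the linear part of the Young functions vanish, and what
    remains is quadratic with an arbitrarily small constant. *)
Lemma low_norm_le I L N a (c : R) : 0 <= c -> c <= hpow I ->
  (0 < L)%N ==> (c <= hpow (growth L + 2 * L)) ->
  (forall n, (n < N)%N -> nrm (a n) <= 1) ->
  c * nu (block_vec N (low I a)) <=
    1 + 2 * hpow (2 * L) * c ^+ 2 * \sum_(0 <= n < N) nrm (a n) ^+ 2.
Proof.
move=> c0 cI cL a1.
have lowE n k : nrm (ofR c * low I a n k) =
    if nrm (a n) * hpow I <= hpow k then c * nrm (a n) else 0.
  by rewrite nrmM nrm_ofR// /low; case: ifP; rewrite ?nrm0 ?mulr0.
have low_hpow n k : nrm (ofR c * low I a n k) <= hpow k.
  rewrite lowE; case: ifP => [ak|_]; last exact: hpow_ge0.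
  by apply: le_trans ak; rewrite mulrC ler_wpM2l ?nrm_ge0.
have low_c n k : nrm (ofR c * low I a n k) <= c * nrm (a n).
  by rewrite lowE; case: ifP => // _; rewrite mulr_ge0 ?nrm_ge0.
have -> : c * nu (block_vec N (low I a)) =
    nu (block_vec N (fun n k => ofR c * low I a n k)).
  by rewrite block_vecZ nuZ nrm_ofR.
apply: le_trans (block_norm_le (L := L) _ _) _.
- move=> n k _ _; rewrite mulr_ile1 ?hpow_ge0 ?nrm_ge0 ?hpow_le1//.
  exact: le_trans (low_hpow n k) (hpow_le1 _).
- move=> n k nN; apply/implyP => L0; move/implyP: cL => /(_ L0); apply: le_trans.
  by rewrite (le_trans (low_c n k))// ler_piMr// a1.
rewrite lerD2l mulr_sumr; apply: ler_sum => n _.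
apply: (@le_trans _ _ (\sum_(0 <= k < n.+2) hpow k * (hpow (2 * L) * c ^+ 2 * nrm (a n) ^+ 2))).
  apply: ler_sum => k _; rewrite /young ltNge low_hpow/= add0r.
  rewrite (@le_trans _ _ (hpow (2 * L + 2 * k) * (c * nrm (a n)) ^+ 2))//.
    by rewrite ler_wpM2l ?hpow_ge0// ler_sqr ?nnegrE ?nrm_ge0 ?mulr_ge0 ?nrm_ge0.
  have -> : hpow (2 * L + 2 * k) = hpow (2 * L) * (hpow k * hpow k) :> R.
    by rewrite -!hpowD; congr hpow; lia.
  rewrite exprMn [leLHS](_ : _ = hpow k * (hpow k * (hpow (2 * L) * c ^+ 2 * nrm (a n) ^+ 2))); last by ring.
  by apply: ler_piMl; rewrite ?hpow_le1 ?(mulr_ge0, hpow_ge0, nrm_ge0).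
rewrite -mulr_suml (le_trans (ler_wpM2r _ (sum_hpow_le2 _)))//.
  by rewrite ?(mulr_ge0, hpow_ge0, nrm_ge0).
by rewrite !mulrA.
Qed.

(** This is the [o(sqrt J)] estimate: it improves on the bound by a multiple of
    [r] that [hilbert_vec_le] would give. *)
Lemma low_norm_small I (e : R) : 0 < e -> exists2 r0 : R, 0 < r0 &
  forall r N a, r0 <= r -> (forall n, (n < N)%N -> nrm (a n) <= 1) ->
    \sum_(0 <= n < N) nrm (a n) ^+ 2 <= r ^+ 2 ->
    nu (block_vec N (low I a)) <= e * r.
Proof.
move=> e0; have [L Le] := @hpow_small R (e ^+ 2 / 8) (divr_gt0 (exprn_gt0 2 e0) (ltr0Sn _ 7)).
(* Scaling by [B / r] turns the constant [1] of the modular bound into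
   [e / 2 * r]; then [L] makes the quadratic term as small. *)
pose B : R := 2 / e; have B0 : 0 < B by rewrite divr_gt0.
pose M := (I + (growth L + 2 * L))%N; have hM := @hpow_gt0 R M.
exists (B / hpow M); first by rewrite divr_gt0.
move=> r N a r0r a1 ar; have r0 : 0 < r.
  by apply: lt_le_trans r0r; rewrite divr_gt0.
have cM : B / r <= hpow M by rewrite ler_pdivrMr// mulrC -ler_pdivrMr.
have c0 : 0 < B / r by rewrite divr_gt0.
have := @low_norm_le I L N a (B / r) (ltW c0).
have -> : B / r <= hpow I by apply: le_trans cM _; apply: le_hpow; rewrite leq_addr.
have -> : (0 < L)%N ==> (B / r <= hpow (growth L + 2 * L)).
  by apply/implyP => _; apply: le_trans cM _; apply: le_hpow; rewrite leq_addl.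
move=> /(_ isT isT a1) h.
rewrite -(ler_pM2l c0) (le_trans h)//.
have -> : B / r * (e * r) = 2 by rewrite /B; field; rewrite !gt_eqF.
have : 2 * hpow (2 * L) * (B / r) ^+ 2 * \sum_(0 <= n < N) nrm (a n) ^+ 2 <=
    2 * hpow (2 * L) * (B / r) ^+ 2 * r ^+ 2.
  by rewrite ler_wpM2l// mulr_ge0 ?sqr_ge0// mulr_ge0 ?hpow_ge0.
have -> : 2 * hpow (2 * L) * (B / r) ^+ 2 * r ^+ 2 = 8 * hpow (2 * L) / e ^+ 2.
  by rewrite /B; field; rewrite !gt_eqF.
have : 8 * hpow (2 * L) / e ^+ 2 <= 1.
  rewrite ler_pdivrMr ?exprn_gt0// mul1r mulrC -ler_pdivlMr//.
  by apply: le_trans (ltW Le); apply: le_hpow; lia.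
lra.
Qed.

Lemma hilbert_vecZ N c a : hilbert_vec N (fun n => c * a n) = c *: hilbert_vec N a.
Proof. exact: block_vecZ. Qed.

Lemma hilbert_vecD N a b :
  hilbert_vec N (fun n => a n + b n) = hilbert_vec N a + hilbert_vec N b.
Proof. exact: block_vecD. Qed.

Definition coef_norm N a : R := l2sum (fun n => nrm (a n)) N.

Lemma sqr_coef_norm N a : coef_norm N a ^+ 2 = \sum_(0 <= n < N) nrm (a n) ^+ 2.
Proof. exact: sqr_l2sum. Qed.

Lemma coef_norm_ge0 N a : 0 <= coef_norm N a.
Proof. exact: l2sum_ge0. Qed.

Lemma coef_normZ N c a : coef_norm N (fun n => c * a n) = nrm c * coef_norm N a.
Proof.
rewrite /coef_norm -l2sumZ ?nrm_ge0//; congr l2sum.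
by apply/funext => n; rewrite nrmM.
Qed.

Lemma coef_norm0 N a : coef_norm N a = 0 -> forall n, (n < N)%N -> a n = 0.
Proof.
move=> a0 n nN; apply: nrm0_eq0; apply/eqP; rewrite -sqrf_eq0 eq_le sqr_ge0 andbT.
have := sqr_coef_norm N a; rewrite a0 expr0n/= => aE; rewrite [leRHS]aE.
rewrite (bigD1_seq n) ?mem_index_iota ?iota_uniq//= lerDl.
by apply: sumr_ge0 => i _; rewrite sqr_ge0.
Qed.

(** Homogeneity reduces estimates of [hilbert_vec] to unit coefficients. *)
Lemma coef_norm_rescale N a (Q : nat -> (nat -> K) -> Prop) :
  (forall c : R, 0 < c -> Q N (fun n => ofR c * a n) -> Q N a) ->
  (coef_norm N a = 0 -> Q N a) -> (forall b, coef_norm N b = 1 -> Q N b) -> Q N a.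
Proof.
move=> QZ Q0 Q1; have [a0|a0] := eqVneq (coef_norm N a) 0; first exact: Q0.
have ap : 0 < coef_norm N a by rewrite lt_neqAle eq_sym a0 coef_norm_ge0.
have cp : 0 < (coef_norm N a)^-1 by rewrite invr_gt0.
apply: (QZ _ cp); apply: Q1.
by rewrite coef_normZ nrm_ofR ?(ltW cp)// mulVf.
Qed.

Lemma hilbert_vec_le N a : nu (hilbert_vec N a) <= 8 * coef_norm N a.
Proof.
apply: (@coef_norm_rescale N a (fun N a => nu (hilbert_vec N a) <= 8 * coef_norm N a)).
- move=> c c0; rewrite hilbert_vecZ nuZ coef_normZ nrm_ofR ?(ltW c0)//.
  by rewrite mulrCA ler_pM2l.
- move=> a0; have -> : hilbert_vec N a = 0 *: hilbert_vec N a.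
    rewrite -hilbert_vecZ; apply: eq_block_vec => n _ nN _.
    by rewrite (coef_norm0 a0)// mulr0.
  by rewrite nuZ nrm0 mul0r mulr_ge0 ?coef_norm_ge0.
move=> b b1; have bs : \sum_(0 <= n < N) nrm (b n) ^+ 2 <= 1 :> R.
  by rewrite -sqr_coef_norm b1 expr1n.
rewrite b1 (hilbert_vecE 0) (le_trans (nuD _ _))//.
have := high_norm_le 0 bs; have := @low_norm_le 0 0 N b 1.
rewrite ler01 /hpow expr0 lexx expr1n !mulr1 mul1r => /(_ isT isT isT).
by move=> /(_ (fun n => coef_le1 bs)); lra.
Qed.

Lemma nrm_phase (k : K) : exists2 c : K, nrm c <= 1 & c * k = ofR (nrm k).
Proof.
have [->|k0] := eqVneq k 0; first by exists 0; rewrite ?mulr0 nrm0 ?ofR0.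
have nk : nrm k != 0 by apply: contra_neq k0; exact: nrm0_eq0.
exists (ofR (nrm k) / k); last by rewrite divfK.
suff -> : nrm (ofR (nrm k) / k) = 1 by [].
by apply: (mulIf nk); rewrite -nrmM divfK// nrm_ofR ?nrm_ge0// mul1r.
Qed.

Lemma dyadic_level (x : R) n : hpow n <= x -> x <= 1 ->
  exists2 k, (k <= n)%N & hpow k <= x <= 2 * hpow k.
Proof.
move=> nx x1; have ex : exists k, hpow k <= x by exists n.
case: (ex_minnP ex) => k kx kmin; exists k; first exact: kmin.
rewrite kx /=; case: k kx kmin => [|k] kx kmin; first by rewrite /hpow expr0; lra.
rewrite /hpow exprS mulrA divff ?pnatr_eq0// mul1r -/(hpow k).
by rewrite leNgt; apply/negP => /ltW /kmin; rewrite ltnn.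
Qed.

Lemma sum_hpow_odd N : 3 * \sum_(0 <= n < N) hpow (2 * n.+1) <= 1 :> R.
Proof.
suff : 3 * \sum_(0 <= n < N) hpow (2 * n.+1) <= 1 - hpow (2 * N) :> R.
  by have := @hpow_ge0 R (2 * N); lra.
elim: N => [|N IH]; first by rewrite big_geq// muln0 /hpow expr0; lra.
rewrite big_nat_recr//= (_ : 2 * N.+1 = 2 * N + 2)%N; last by lia.
have h2 : hpow 2 = 4^-1 :> R by rewrite /hpow; field.
by rewrite hpowD h2; lra.
Qed.

End Blocks.

Section LowerBound.
Context {R : realType} {s : scalars}.
Local Notation K := (scalar_field R s).
Local Notation H := (ell2 R s).
Local Notation nu := (level_norm H H).
Implicit Types (a : nat -> K) (v : nat -> nat -> K).

Lemma entry_block_vec N v t :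
  entry t (block_vec N v) = if t \in blocks N then ofR (height t.1.2) * v t.1.1 t.1.2 else 0.
Proof. by rewrite entry_diag_tensor// blocks_uniq. Qed.

Lemma sum_selected (V : nmodType) (F : nat -> nat -> V) N (sel : pred nat)
    (kf : nat -> nat) : (forall n, (n < N)%N -> sel n -> (kf n < n.+2)%N) ->
  \sum_(t <- [seq t <- blocks N | sel t.1.1 && (t.1.2 == kf t.1.1)]) F t.1.1 t.1.2 =
  \sum_(0 <= n < N | sel n) F n (kf n) *+ multiplicity (kf n).
Proof.
move=> kn; rewrite big_filter big_mkcond sum_blocks [RHS]big_mkcond.
apply: eq_big_nat => n /andP[_ nN] /=; case: ifP => [nsel|_]; last first.
  by rewrite big1// => k _; rewrite big1.
rewrite (bigD1_seq (kf n)) ?mem_index_iota ?iota_uniq ?kn//= eqxx.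
rewrite sumr_const_nat subn0 [X in _ + X]big1 ?addr0// => k /negPf kk.
by rewrite kk big1.
Qed.

(** The functional testing [sum_n a_n y_n] picks for each [n] the level [k] with
    [2^-k] comparable to [|a_n|]. The coefficients for which [k > n + 1] would be
    required carry at most a third of the mass. *)
Lemma coef_norm_le N a : coef_norm N a <= 3 * nu (hilbert_vec N a).
Proof.
apply: (@coef_norm_rescale _ _ N a (fun N a => coef_norm N a <= 3 * nu (hilbert_vec N a))).
- move=> c c0; rewrite hilbert_vecZ nuZ coef_normZ nrm_ofR ?(ltW c0)//.
  by rewrite mulrCA ler_pM2l.
- by move=> ->; rewrite mulr_ge0 ?nu_ge0.
move=> {}a a1; rewrite a1; have as1 : \sum_(0 <= n < N) nrm (a n) ^+ 2 = 1 :> R.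
  by rewrite -sqr_coef_norm a1 expr1n.
have as2 : \sum_(0 <= n < N) nrm (a n) ^+ 2 <= 1 :> R by rewrite as1.
pose sel : pred nat := fun n => hpow n.+1 <= nrm (a n).
have /choice[kf kfP] (n : nat) : exists k, (n < N)%N -> sel n ->
    (k < n.+2)%N /\ hpow k <= nrm (a n) <= 2 * hpow k.
  have [nN|] := boolP (n < N)%N; last by exists 0%N.
  have [ns|] := boolP (sel n); last by exists 0%N.
  have [k kn kx] := dyadic_level ns (coef_le1 as2 nN).
  by exists k.
have kfn n : (n < N)%N -> sel n -> (kf n < n.+2)%N by move=> nN /(kfP _ nN)[].
have /choice[cf cfP] (n : nat) : exists c : K, nrm c <= 1 /\ c * a n = ofR (nrm (a n)).
  by have [c] := nrm_phase (a n); exists c.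
pose P := [seq t <- blocks N | sel t.1.1 && (t.1.2 == kf t.1.1)].
have Pu : uniq P by rewrite filter_uniq// blocks_uniq.
have costP : \sum_(t <- P) cost t.1.2 <= 1 :> R.
  rewrite (sum_selected (fun _ k => cost k : R) kfn) -as1 [leLHS]big_mkcond /=.
  rewrite big_nat [leRHS]big_nat; apply: ler_sum => n /andP[_ nN].
  case: ifP => [/(kfP _ nN)[_ /andP[kx _]]|_]; last exact: sqr_ge0.
  rewrite /cost hpowD -mulr_natr -mulrA [_ * (multiplicity _)%:R]mulrC multiplicityE mulr1.
  rewrite mul2n -addnn hpowD -expr2 ler_sqr ?nnegrE ?hpow_ge0//; exact: nrm_ge0.
have := entries_le_norm (hilbert_vec N a) Pu (fun t : triple => (cfP t.1.1).1) costP.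
have -> : \sum_(t <- P) ofR (weight t.1.2) *: (cf t.1.1 *: entry t (hilbert_vec N a)) =
    ofR (\sum_(0 <= n < N | sel n) hpow (kf n) * nrm (a n)) :> K.
  transitivity (\sum_(t <- P) ofR (weight t.1.2 * height t.1.2 * nrm (a t.1.1)) : K).
    rewrite big_seq [RHS]big_seq; apply: eq_bigr => t; rewrite mem_filter => /andP[_ tP].
    rewrite entry_block_vec tP !ofRM -(cfP t.1.1).2 -mulrA (mulrCA (ofR (height _))).
    by [].
  rewrite (sum_selected (fun n k => ofR (weight k * height k * nrm (a n)) : K) kfn).
  rewrite (big_morph ofR (@ofRD R s) (@ofR0 R s)); apply: eq_bigr => n _.
  rewrite -mulr_natr.
  have -> : (multiplicity (kf n))%:R = ofR (multiplicity (kf n))%:R :> K.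
    elim: (multiplicity _) => [|m IH]; first by rewrite ofR0.
    by rewrite -!natr1 ofRD IH ofR1.
  rewrite -ofRM; congr ofR; rewrite mulrAC; congr (_ * _).
  rewrite mulrC /weight /height -hpowD.
  rewrite (_ : 3 * growth (kf n) + (kf n + growth (kf n)) = 4 * growth (kf n) + kf n)%N; last by lia.
  by rewrite hpowD mulrA multiplicityE mul1r.
have S0 : 0 <= \sum_(0 <= n < N | sel n) hpow (kf n) * nrm (a n) :> R.
  by apply: sumr_ge0 => n _; rewrite mulr_ge0 ?hpow_ge0 ?nrm_ge0.
rewrite nrm_ofR// => Sle.
have selS : \sum_(0 <= n < N | sel n) nrm (a n) ^+ 2 <=
    2 * \sum_(0 <= n < N | sel n) hpow (kf n) * nrm (a n) :> R.
  rewrite mulr_sumr [leLHS]big_mkcond [leRHS]big_mkcond /= big_nat [leRHS]big_nat.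
  apply: ler_sum => n /andP[_ nN]; case: ifP => // /(kfP _ nN)[_ /andP[_ xk]].
  by rewrite mulrA expr2 ler_wpM2r ?nrm_ge0.
have nselS : 3 * \sum_(0 <= n < N | ~~ sel n) nrm (a n) ^+ 2 <= 1 :> R.
  apply: le_trans (sum_hpow_odd N); rewrite ler_pM2l// big_mkcond /=.
  apply: ler_sum => n _; rewrite -ltNge; case: ifP => [/ltW xn|_]; last exact: hpow_ge0.
  by rewrite mul2n -addnn hpowD -expr2 ler_sqr ?nnegrE ?hpow_ge0 ?nrm_ge0.
have massE : \sum_(0 <= n < N | sel n) nrm (a n) ^+ 2 +
    \sum_(0 <= n < N | ~~ sel n) nrm (a n) ^+ 2 = 1 :> R by rewrite -as1 [RHS](bigID sel).
lra.
Qed.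

End LowerBound.

Section Coefficients.
Context {R : realType} {s : scalars}.
Local Notation K := (scalar_field R s).
Local Notation H := (ell2 R s).
Local Notation nu := (level_norm H H).
Implicit Types (a : nat -> K) (v : nat -> nat -> K).

Definition coef n (x : tensor H H) : K^o := entry (n, 0, 0)%N x.

Lemma coef_hilbert_vec N a n : coef n (hilbert_vec N a) = if (n < N)%N then a n else 0.
Proof.
rewrite /coef entry_block_vec mem_blocks /= /multiplicity muln0 expn0 andbT.
by rewrite /height /hpow expr0 ofR1 mul1r.
Qed.

Lemma block_vec_pad M N v : (forall n k, (M <= n)%N -> v n k = 0) -> (M <= N)%N ->
  block_vec N v = block_vec M v.
Proof.
move=> v0 MN; rewrite /block_vec /diag_tensor !sum_blocks.
rewrite (big_cat_nat _ MN)//= [X in _ + X]big_nat [X in _ + X]big1 ?addr0//.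
move=> n /andP[nM _]; apply: big1 => k _; apply: big1 => i _.
by rewrite /= v0// mulr0 scale0r.
Qed.

Lemma low_eq0 I a n k : a n = 0 -> low I a n k = 0.
Proof. by rewrite /low => ->; case: ifP. Qed.

Lemma lowZ I (e : K) a n k : nrm e = 1 -> low I (fun n => e * a n) n k = e * low I a n k.
Proof. by rewrite /low => e1; rewrite nrmM e1 mul1r; case: ifP; rewrite ?mulr0. Qed.

Lemma lowD I a b n k : a n = 0 \/ b n = 0 ->
  low I (fun n => a n + b n) n k = low I a n k + low I b n k.
Proof.
by move=> [] e; rewrite /low e ?addr0 ?add0r nrm0 mul0r hpow_ge0 ?addr0 ?add0r.
Qed.

Section DisjointBlocks.
Context (M : nat -> nat) (a : nat -> nat -> K) (e : nat -> K).
Context (Mnd : forall j, (M j <= M j.+1)%N).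
Context (a_supp : forall j n, ~~ (M j <= n < M j.+1)%N -> a j n = 0).
Context (e1 : forall j, nrm (e j) = 1).

Definition assemble J n : K := \sum_(0 <= j < J) e j * a j n.

Lemma assembleS J n : assemble J.+1 n = assemble J n + e J * a J n.
Proof. by rewrite /assemble big_nat_recr. Qed.

Lemma assemble_supp J n : (M J <= n)%N -> assemble J n = 0.
Proof.
elim: J => [|J IH] Mn; first by rewrite /assemble big_geq.
rewrite assembleS IH ?(leq_trans (Mnd J))// add0r a_supp ?mulr0//.
by rewrite negb_and -leqNgt Mn orbT.
Qed.

Lemma assemble_disjoint J n : assemble J n = 0 \/ e J * a J n = 0.
Proof.
have [Mn|nM] := leqP (M J) n; first by left; exact: assemble_supp.
by right; rewrite a_supp ?mulr0// negb_and -ltnNge nM.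
Qed.

Lemma assemble_le1 J n : (forall j n, nrm (a j n) <= 1) -> nrm (assemble J n) <= 1.
Proof.
move=> a1; elim: J => [|J IH]; first by rewrite /assemble big_geq// nrm0.
rewrite assembleS; have [->|->] := assemble_disjoint J n; rewrite ?addr0// add0r.
by rewrite nrmM e1 mul1r.
Qed.

Lemma assemble_sqr_le J N :
  (forall j, \sum_(0 <= n < N) nrm (a j n) ^+ 2 <= 1 :> R) ->
  \sum_(0 <= n < N) nrm (assemble J n) ^+ 2 <= J%:R.
Proof.
move=> a1; elim: J => [|J IH].
  by rewrite big1// => n _; rewrite /assemble big_geq// nrm0 expr0n.
rewrite -natr1 (le_trans _ (lerD IH (a1 J)))// -big_split /=.
apply: ler_sum => n _; rewrite assembleS.
by have [->|] := assemble_disjoint J n => [|aJ0];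
  rewrite ?aJ0 ?addr0 ?add0r ?nrmM ?e1 ?mul1r ?lerDl ?lerDr ?sqr_ge0.
Qed.

Lemma block_vec_low_assemble I J N :
  block_vec N (low I (assemble J)) = \sum_(0 <= j < J) e j *: block_vec N (low I (a j)).
Proof.
elim: J => [|J IH].
  rewrite big_geq// (eq_block_vec (w := fun n k => 0 * 0)).
    by rewrite block_vecZ scale0r.
  by move=> n k _ _; rewrite low_eq0 ?mulr0// /assemble big_geq.
rewrite big_nat_recr//= -IH -block_vecZ -block_vecD; apply: eq_block_vec => n k _ _.
have -> : low I (assemble J.+1) n k = low I (fun n => assemble J n + e J * a J n) n k.
  by rewrite /low !assembleS.
by rewrite lowD ?lowZ//; exact: assemble_disjoint.
Qed.

End DisjointBlocks.

End Coefficients.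

(** * Linear algebra in infinite-dimensional subspaces *)

Section InfiniteDim.
Context {R : realType} {s : scalars}.
Local Notation K := (scalar_field R s).
Context {V : normedModType K}.
Implicit Types (Z : set V).

Definition lin_closed Z := Z 0 /\ forall (a : K) u v, Z u -> Z v -> Z (a *: u + v).

(** If the kernel of [f] in [Z] were finite-dimensional, adding one vector outside
    the kernel would span [Z]. *)
Lemma infinite_dim_ker Z (f : V -> K^o) : lin_closed Z -> linear f ->
  infinite_dim Z -> infinite_dim [set z | Z z /\ f z = 0].
Proof.
move=> [Z0 Zl] fl Zinf [n [e eP]]; apply: Zinf.
have [[z0 Zz0 fz0]|noz] := pselect (exists2 z, Z z & f z != 0); last first.
  exists n, e => z Zz; apply: eP; split=> //; apply: contrapT => /eqP fz.
  by apply: noz; exists z.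
exists n.+1, (fun i => if unlift ord0 i is Some j then e j else z0) => z Zz.
have [|c cE] := eP (- (f z / f z0) *: z0 + z).
  split; first exact: Zl.
  by rewrite fl (_ : _ *: f z0 = - (f z / f z0) * f z0)// mulNr divfK// addNr.
exists (fun i => if unlift ord0 i is Some j then c j else f z / f z0).
rewrite big_ord_recl unlift_none; under eq_bigr do rewrite liftK.
by rewrite -cE scaleNr addrA subrr add0r.
Qed.

Lemma infinite_dim_kers Z (g : nat -> V -> K^o) N : lin_closed Z ->
  (forall n, linear (g n)) -> infinite_dim Z ->
  infinite_dim [set z | Z z /\ forall n, (n < N)%N -> g n z = 0].
Proof.
move=> Zl gl Zinf; elim: N => [|N IH].
  by rewrite (_ : [set z | _] = Z)//; apply/seteqP; split=> z // [].
pose Z' := [set z | Z z /\ forall n, (n < N)%N -> g n z = 0].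
have Zl' : lin_closed Z'.
  split; first by split=> [|n _]; [exact: Zl.1|exact: lin0].
  move=> a u v [Zu ug] [Zv vg]; split=> [|n nN]; first exact: Zl.2.
  by rewrite gl ug// vg// scaler0 addr0.
have := infinite_dim_ker Zl' (gl N) IH.
rewrite (_ : [set z | Z' z /\ g N z = 0] = [set z | Z z /\ forall n, (n < N.+1)%N -> g n z = 0])//.
apply/seteqP; split=> z /=.
  move=> [[Zz zg] zN]; split=> // n; rewrite ltnS leq_eqVlt => /predU1P[->//|].
  exact: zg.
by move=> [Zz zg]; split; [split=> // n nN; apply: zg; exact: ltnW|exact: zg].
Qed.

Lemma infinite_dim_nonzero Z : infinite_dim Z -> exists2 z, Z z & z != 0.
Proof.
move=> Zinf; apply: contrapT => noz; apply: Zinf.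
exists 0%N, (fun=> 0) => z Zz; exists (fun=> 0); rewrite big_ord0.
by apply: contrapT => /eqP z0; apply: noz; exists z.
Qed.

(** Otherwise [n + 1] of the vectors [y i] would be combinations of [n] vectors,
    hence linearly related, which the functionals [g m] exclude. *)
Lemma biorthogonal_infinite_dim Z (y : nat -> V) (g : nat -> V -> K^o) :
  (forall n, linear (g n)) -> (forall n, Z (y n)) ->
  (forall m n, g m (y n) = (m == n)%:R) -> infinite_dim Z.
Proof.
move=> gl Zy gy [n [e eP]].
have /choice[c cP] (i : nat) : exists c : 'I_n -> K, y i = \sum_j c j *: e j.
  exact: eP.
pose C : 'M[K]_(n.+1, n) := \matrix_(i, j) c i j.
have : kermx C != 0.
  apply/eqP => C0; have := rank_leq_col C.
  have : row_free C by rewrite -kermx_eq0 C0.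
  by rewrite /row_free => /eqP ->; rewrite ltnn.
move=> /rowV0Pn[r /sub_kermxP rC r0].
have ry : \sum_(i < n.+1) r 0 i *: y i = 0.
  under eq_bigr => i _ do rewrite cP scaler_sumr.
  rewrite exchange_big big1//= => j _.
  under eq_bigr => i _ do rewrite scalerA.
  have rCj : \sum_i r 0 i * c i j = 0.
    transitivity ((r *m C) 0 j); last by rewrite rC mxE.
    by rewrite mxE; apply: eq_bigr => i _; rewrite mxE.
  by rewrite -scaler_suml rCj scale0r.
case/eqP: r0; apply/rowP => m; rewrite mxE.
have := lin0 (gl m); rewrite -{1}ry (lin_sum (gl m)) (bigD1 m)//= linZ// gy eqxx.
rewrite big1 ?addr0 => [|i im]; last first.
  by rewrite linZ// gy (_ : (_ == _) = false) ?scaler0// eq_sym; exact: negPf.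
by rewrite (_ : r 0 m *: 1 = r 0 m * 1)// mulr1.
Qed.

End InfiniteDim.

Section Signs.
Context {R : realType} {s : scalars}.
Local Notation K := (scalar_field R s).

Lemma nrm_parallelogram (x y : K) :
  nrm (x + y) ^+ 2 + nrm (x - y) ^+ 2 = 2 * (nrm x ^+ 2 + nrm y ^+ 2).
Proof.
rewrite /nrm/re; move: x y; case: s => /= [x y|[a b] [c d]] /=.
  by rewrite !real_normK ?num_real//; ring.
rewrite !sqr_sqrtr ?addr_ge0 ?sqr_ge0//; ring.
Qed.

(** By the parallelogram identity one of the two signs makes the next term
    increase the square norm by at least its own square norm. *)
Lemma exists_signs N J (u : nat -> nat -> K) : exists e : nat -> K,
  (forall j, nrm (e j) = 1) /\
  \sum_(0 <= j < J) coef_norm N (u j) ^+ 2 <=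
    coef_norm N (fun n => \sum_(0 <= j < J) e j * u j n) ^+ 2.
Proof.
elim: J => [|J [e [e1 eP]]].
  by exists (fun=> 1); split=> [_|]; [rewrite -(@ofR1 R s) nrm_ofR|rewrite big_geq// sqr_ge0].
pose w n : K := \sum_(0 <= j < J) e j * u j n.
have par : coef_norm N (fun n => w n + u J n) ^+ 2 + coef_norm N (fun n => w n - u J n) ^+ 2 =
    2 * (coef_norm N w ^+ 2 + coef_norm N (u J) ^+ 2).
  rewrite !sqr_coef_norm -!big_split /= mulr_sumr; apply: eq_bigr => n _.
  exact: nrm_parallelogram.
suff [c c1 cP] : exists2 c : K, nrm c = 1 &
    coef_norm N w ^+ 2 + coef_norm N (u J) ^+ 2 <= coef_norm N (fun n => w n + c * u J n) ^+ 2.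
  exists (fun j => if j == J then c else e j); split=> [j|]; first by case: ifP.
  rewrite big_nat_recr//= (le_trans (lerD eP (lexx _)))// (le_trans cP)//.
  rewrite (_ : (fun n => w n + _) = (fun n => \sum_(0 <= j < J.+1) (if j == J then c else e j) * u j n))//.
  apply/funext => n; rewrite big_nat_recr//= eqxx; congr (_ + _).
  by apply: eq_big_nat => j /andP[_ jJ]; rewrite (ltn_eqF jJ).
have n1 : nrm (1 : K) = 1 by rewrite -(@ofR1 R s) nrm_ofR.
have [le|lt] := leP (coef_norm N (fun n => w n - u J n)) (coef_norm N (fun n => w n + u J n)).
  exists 1 => //; rewrite (_ : (fun n => w n + 1 * _) = (fun n => w n + u J n)); last first.
    by apply/funext => n; rewrite mul1r.
  have := le; rewrite -(@ler_sqr R) ?nnegrE ?coef_norm_ge0//; lra.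
exists (-1); first by rewrite nrmN.
rewrite (_ : (fun n => w n + -1 * _) = (fun n => w n - u J n)); last first.
  by apply/funext => n; rewrite mulN1r.
have := ltW lt; rewrite -(@ler_sqr R) ?nnegrE ?coef_norm_ge0//; lra.
Qed.

Lemma coef_normD N (a b : nat -> K) :
  coef_norm N (fun n => a n + b n) <= coef_norm N a + coef_norm N b.
Proof.
apply: le_trans (l2sumD _ _ _); apply: ler_l2sum => n _.
by rewrite ger0_norm ?nrm_ge0// nrmD.
Qed.

Lemma le_coef_norm M N (a : nat -> K) : (M <= N)%N -> coef_norm M a <= coef_norm N a.
Proof.
move=> MN; rewrite -(@ler_sqr R) ?nnegrE ?coef_norm_ge0// !sqr_coef_norm.
rewrite (big_cat_nat _ MN)//= lerDl; apply: sumr_ge0 => i _; exact: sqr_ge0.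
Qed.

Lemma coef_norm_cst N (a : nat -> K) (c : R) : 0 <= c ->
  (forall n, nrm (a n) <= c) -> coef_norm N a <= N%:R * c.
Proof.
move=> c0 ac; apply: le_trans (l2sum_cst N c0); apply: ler_l2sum => n _.
by rewrite ger0_norm ?nrm_ge0.
Qed.

End Signs.

(** * The Hilbertian subspace contains no infinite-dimensional complemented one *)

Section NotSubprojective.
Context {R : realType} {s : scalars}.
Local Notation K := (scalar_field R s).
Local Notation H := (ell2 R s).
Local Notation nu := (level_norm H H).
Context (V : normedModType K) (embed : tensor H H -> V) (g : nat -> V -> K^o).
Context (embed_linear : linear embed) (nrm_embed : forall x, nrm (embed x) = nu x).
Context (gP : forall n,
  [/\ linear (g n), forall x, nrm (g n x) <= nrm x & forall x, g n (embed x) = coef n x]).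

Let gl n : linear (g n). Proof. by have [] := gP n. Qed.
Let g1 n x : nrm (g n x) <= nrm x. Proof. by have [] := gP n. Qed.
Let gE n x : g n (embed x) = coef n x. Proof. by have [] := gP n. Qed.

Local Notation hv N a := (embed (hilbert_vec N a)).

Lemma hvZ N c a : hv N (fun n => c * a n) = c *: hv N a.
Proof. by rewrite hilbert_vecZ (linZ embed_linear). Qed.

Lemma hvD N a b : hv N (fun n => a n + b n) = hv N a + hv N b.
Proof. by rewrite hilbert_vecD (linD embed_linear). Qed.

Definition hilbert_space : set V :=
  [set x | forall e : R, 0 < e -> exists N a, nrm (x - hv N a) < e].

Lemma hilbert_space_approx x (e : R) N0 : hilbert_space x -> 0 < e -> exists N a,
  [/\ (N0 <= N)%N, forall n, (N <= n)%N -> a n = 0 & nrm (x - hv N a) < e].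
Proof.
move=> Yx /Yx[M [a xa]]; exists (maxn M N0), (fun n => if (n < M)%N then a n else 0).
split; first exact: leq_maxr.
  by move=> n; rewrite geq_max => /andP[Mn _]; rewrite ltnNge Mn.
rewrite [hilbert_vec _ _](_ : _ = hilbert_vec M a)//.
rewrite /hilbert_vec (block_vec_pad (M := M)) ?leq_maxl//; last first.
  by move=> n _ Mn; rewrite ltnNge Mn.
by apply: eq_block_vec => n _ nM _; rewrite nM.
Qed.

Lemma g_hv N a n : (forall n, (N <= n)%N -> a n = 0) -> g n (hv N a) = a n.
Proof.
by move=> a0; rewrite gE coef_hilbert_vec; case: ltnP => // /a0->.
Qed.

Lemma hilbert_space_hv N a : hilbert_space (hv N a).
Proof. by move=> e e0; exists N, a; rewrite subrr nrm0. Qed.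

Lemma hilbert_space_lin : lin_closed hilbert_space.
Proof.
have Y0 : hilbert_space 0.
  have := hilbert_space_hv 0 (fun=> 0).
  rewrite (_ : hilbert_vec 0 _ = 0) ?(lin0 embed_linear)//.
  exact: big_nil.
split=> [|c u v Yu Yv e e0]; first exact: Y0.
have c0 : 0 < nrm c + 1 by rewrite ltr_wpDl ?nrm_ge0.
have e20 : 0 < e / 2 by rewrite divr_gt0.
have [N [a [_ a0 ua]]] := hilbert_space_approx 0 Yu (divr_gt0 e20 c0).
have [M [b [NM b0 vb]]] := hilbert_space_approx N Yv e20.
exists M, (fun n => c * a n + b n).
have -> : hv M (fun n => c * a n + b n) = c *: hv N a + hv M b.
  rewrite hvD hvZ; congr (_ *: embed _ + _); apply: block_vec_pad => // n _ Nn.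
  exact: a0.
rewrite opprD addrACA -scalerBr (le_lt_trans (nrmD _ _))// [ltRHS]splitr ler_ltD//.
rewrite nrmZ (@le_trans _ _ ((nrm c + 1) * nrm (u - hv N a)))//.
  by rewrite ler_wpM2r ?nrm_ge0// lerDl.
by rewrite mulrC -ler_pdivlMr// ltW.
Qed.

Lemma hilbert_spaceB x y : hilbert_space x -> hilbert_space y -> hilbert_space (x - y).
Proof. by move=> Yx Yy; rewrite -scaleN1r addrC; exact: hilbert_space_lin.2. Qed.

Lemma hilbert_space_closed : closed_subspace hilbert_space.
Proof.
split; [exact: hilbert_space_lin.1|exact: hilbert_space_lin.2|].
move=> x clx e e0; have e20 : 0 < e / 2 by rewrite divr_gt0.
have [|y [Yy]] := clx (ball x (ofR (e / 2))).
  by apply: nbhsx_ballx; rewrite -ofR0 ofR_lt.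
rewrite ball_ofR /= => xy; have [N [a ya]] := Yy _ e20.
exists N, a; rewrite (le_lt_trans (nrm_dist_triangle _ y _))//.
by rewrite [ltRHS]splitr ltrD.
Qed.

Lemma hilbert_space_infinite : infinite_dim hilbert_space.
Proof.
pose d n (m : nat) : K := (m == n)%:R.
apply: (biorthogonal_infinite_dim (y := fun n => hv n.+1 (d n)) gl).
  by move=> n; exact: hilbert_space_hv.
by move=> m n; rewrite g_hv// => k nk; rewrite /d gtn_eqF.
Qed.

(** The estimates [coef_norm_le] and [hilbert_vec_le] pass from combinations of the
    [y_n] to their closure. *)
Lemma coef_le_nrm N x : hilbert_space x -> coef_norm N (fun n => g n x) <= 3 * nrm x.
Proof.
move=> Yx; apply/ler_addgt0Pr => e e0.
have c0 : (0 : R) < 3 + N%:R by rewrite ltr_pwDl.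
have e'0 : 0 < e / (3 + N%:R) by rewrite divr_gt0.
have [M [a [NM a0 xa]]] := hilbert_space_approx N Yx e'0.
set w := hv M a in xa; set e' := e / _ in e'0 xa.
have -> : e = 3 * e' + N%:R * e' by rewrite -mulrDl mulrC divfK// gt_eqF.
have -> : (fun n => g n x) = (fun n => g n w + g n (x - w)).
  by apply/funext => n; rewrite -(linD (gl n)) addrC subrK.
rewrite addrA (le_trans (coef_normD _ _ _))// lerD//; last first.
  apply: coef_norm_cst => [|n]; first exact: ltW.
  by rewrite (le_trans (g1 n _))// ltW.
apply: (@le_trans _ _ (3 * nrm w)).
  have -> : (fun n => g n w) = a by apply/funext => n; exact: g_hv.
  by rewrite (le_trans (le_coef_norm a NM))// nrm_embed; exact: coef_norm_le.
rewrite -mulrDr ler_pM2l// -(subrK x w) addrC (le_trans (nrmD _ _))// lerD2l nrmB.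
exact: ltW.
Qed.

Lemma nrm_le_coef x : hilbert_space x -> x != 0 ->
  exists N, nrm x <= 16 * coef_norm N (fun n => g n x).
Proof.
move=> Yx x0; have nx0 : 0 < nrm x.
  by rewrite lt_neqAle nrm_ge0 andbT eq_sym; apply: contra_neq x0; exact: nrm0_eq0.
have e0 : 0 < nrm x / 50 by rewrite divr_gt0.
have [N [a [_ a0 xa]]] := hilbert_space_approx 0 Yx e0.
exists N; set w := hv N a in xa.
have wE : coef_norm N a <= coef_norm N (fun n => g n x) + 3 * nrm (w - x).
  have -> : a = (fun n => g n x + g n (w - x)).
    by apply/funext => n; rewrite -(linD (gl n)) addrC subrK g_hv.
  rewrite (le_trans (coef_normD _ _ _))// lerD2l coef_le_nrm//.
  by apply: hilbert_spaceB => //; exact: hilbert_space_hv.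
have w8 : nrm w <= 8 * coef_norm N a by rewrite nrm_embed; exact: hilbert_vec_le.
have xw : nrm x <= nrm (x - w) + nrm w by rewrite -{1}(subrK w x) nrmD.
rewrite (nrmB w x) in wE; lra.
Qed.

(** The gliding hump: [Z] has nonzero elements whose first [N0] coefficients vanish,
    and deleting those coefficients from a good approximation costs little. *)
Lemma gliding_block (Z : set V) (eta : R) N0 : Z `<=` hilbert_space ->
  lin_closed Z -> infinite_dim Z -> 0 < eta -> eta <= 1 / 12 ->
  exists z N a, [/\ Z z /\ nrm z = 1 / 4, (N0 <= N)%N,
    forall n, ~~ (N0 <= n < N)%N -> a n = 0, coef_norm N a <= 1 &
    nrm (z - hv N a) <= eta].
Proof.
move=> ZY Zl Zinf eta0 eta12.
have [z0 [Zz0 z0g] z0n] := infinite_dim_nonzero (infinite_dim_kers (N := N0) Zl gl Zinf).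
have nz0 : 0 < nrm z0.
  by rewrite lt_neqAle nrm_ge0 andbT eq_sym; apply: contra_neq z0n; exact: nrm0_eq0.
pose c : R := 1 / 4 / nrm z0; have c0 : 0 <= c by rewrite !divr_ge0 ?nrm_ge0.
pose z : V := ofR c *: z0.
have Zz : Z z by rewrite /z -[_ *: _]addr0; apply: Zl.2 => //; exact: Zl.1.
have nz : nrm z = 1 / 4 by rewrite nrmZ nrm_ofR// divfK ?gt_eqF.
have zg n : (n < N0)%N -> g n z = 0 by move=> nN; rewrite /z (linZ (gl n)) z0g// scaler0.
have e'0 : 0 < eta / 25 by rewrite divr_gt0.
have [N [a [NN0 a0 za]]] := hilbert_space_approx N0 (ZY _ Zz) e'0.
pose b n : K := if (n < N0)%N then a n else 0.
pose a' n : K := if (n < N0)%N then 0 else a n.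
have aE : hv N a = hv N a' + hv N b.
  rewrite -hvD; congr embed; apply: eq_block_vec => n _ _ _.
  by rewrite /a' /b; case: ifP; rewrite ?addr0 ?add0r.
have bE : nrm (hv N b) <= 24 * nrm (z - hv N a).
  have b0 n : (N0 <= n)%N -> b n = 0 by rewrite /b ltnNge => ->.
  have -> : nrm (hv N b) = nu (hilbert_vec N0 b).
    by rewrite nrm_embed /hilbert_vec (block_vec_pad (M := N0))// => n _; exact: b0.
  apply: le_trans (hilbert_vec_le _ _) _.
  rewrite (_ : 24 = 8 * 3); last by rewrite -natrM.
  rewrite -mulrA ler_pM2l// nrmB.
  apply: le_trans (_ : coef_norm N0 (fun n => g n (hv N a - z)) <= _); last first.
    by apply: coef_le_nrm; apply: hilbert_spaceB; [exact: hilbert_space_hv|exact: ZY].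
  rewrite -(@ler_sqr R) ?nnegrE ?coef_norm_ge0// !sqr_coef_norm.
  rewrite big_nat [leRHS]big_nat; apply: ler_sum => n /andP[_ nN].
  by rewrite linB// zg// subr0 g_hv// /b nN.
have za' : nrm (z - hv N a') <= eta.
  have -> : z - hv N a' = (z - hv N a) + hv N b by rewrite aE opprD addrA subrK.
  apply: le_trans (nrmD _ _) _; lra.
exists z, N, a'; split=> //.
- move=> n; rewrite negb_and -ltnNge -leqNgt /a'; case: ltnP => //= _; exact: a0.
apply: le_trans (coef_norm_le _ _) _; rewrite -nrm_embed.
have : nrm (hv N a') <= nrm z + nrm (z - hv N a').
  by rewrite -{1}(subKr z (hv N a')) -[nrm (z - _)]nrmN nrmD.
lra.
Qed.

(** A block [w] close to [z = P z] has a small high part, so that [P] cannot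
    shrink its low part much. *)
Lemma low_block_survives (Z : set V) (P : V -> V) (C : R) : Z `<=` hilbert_space ->
  lin_closed Z -> infinite_dim Z -> linear P -> 0 < C ->
  (forall v, nrm (P v) <= C * nrm v) -> (forall z, Z z -> P z = z) ->
  exists I, forall N0, exists N a, [/\ (N0 <= N)%N,
    forall n, ~~ (N0 <= n < N)%N -> a n = 0, coef_norm N a <= 1 &
    1 / 16 <= nrm (P (embed (block_vec N (low I a))))].
Proof.
move=> ZY Zl Zinf Pl C0 PC PZ.
have [I CI] := @hpow_small R (1 / (80 * C)) (divr_gt0 ltr01 (mulr_gt0 (ltr0Sn _ 79) C0)).
have CI' : C * (5 * hpow I) <= 1 / 16.
  have := ltW CI; rewrite ler_pdivlMr ?mulr_gt0// => h; lra.
exists I => N0; pose eta : R := Num.min (1 / 12) (1 / (8 * C)).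
have eta0 : 0 < eta by rewrite lt_min !divr_gt0// mulr_gt0.
have eta12 : eta <= 1 / 12 by rewrite ge_min lexx.
have Ceta : C * eta <= 1 / 8.
  have : eta <= 1 / (8 * C) by rewrite ge_min lexx orbT.
  rewrite ler_pdivlMr ?mulr_gt0// => h; lra.
have [z [N [a [[Zz nz] NN0 a0 a1 za]]]] := @gliding_block Z eta N0 ZY Zl Zinf eta0 eta12.
exists N, a; split=> //.
have as1 : \sum_(0 <= n < N) nrm (a n) ^+ 2 <= 1 :> R.
  by rewrite -sqr_coef_norm expr_le1 ?coef_norm_ge0.
have zE : z = (z - hv N a) + embed (block_vec N (high I a)) + embed (block_vec N (low I a)).
  by rewrite -addrA -(linD embed_linear) (addrC (block_vec N (high I a))) -hilbert_vecE subrK.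
have : nrm z <= nrm (P (z - hv N a)) + nrm (P (embed (block_vec N (high I a)))) +
    nrm (P (embed (block_vec N (low I a)))).
  rewrite -{1}(PZ z Zz) {1}zE 2!(linD Pl).
  by rewrite (le_trans (nrmD _ _))// lerD2r nrmD.
have := le_trans (PC _) (ler_wpM2l (ltW C0) za).
have := PC (embed (block_vec N (high I a))); rewrite nrm_embed.
move/le_trans => /(_ _ (ler_wpM2l (ltW C0) (high_norm_le I as1))).
rewrite nz; lra.
Qed.

Lemma no_complemented_subspace (Z : set V) : Z `<=` hilbert_space ->
  closed_subspace Z -> infinite_dim Z -> ~ complemented Z.
Proof.
move=> ZY [Z0 Zc _] Zinf [P [Pc PP PZ]]; have Pl : linear P := linearP P.
have [C C0 PC] := continuous_bounded Pl Pc.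
have Pid z : Z z -> P z = z by rewrite -PZ => -[v _ <-]; exact: PP.
have PinY v : hilbert_space (P v) by apply: ZY; rewrite -PZ; exists v.
have [I /choice[Nf /choice[af blockP]]] :=
  low_block_survives ZY (conj Z0 Zc) Zinf Pl C0 PC Pid.
pose M j := iter j Nf 0%N; pose a j := af (M j).
have Mnd j : (M j <= M j.+1)%N by have [] := blockP (M j).
have a_supp j n : ~~ (M j <= n < M j.+1)%N -> a j n = 0.
  by have [_ + _ _] := blockP (M j); apply.
have a1 j : coef_norm (M j.+1) (a j) <= 1 by have [] := blockP (M j).
pose lowv N j : V := embed (block_vec N (low I (a j))).
have a_low j : 1 / 16 <= nrm (P (lowv (M j.+1) j)) by have [] := blockP (M j).
have a_sq j N : \sum_(0 <= n < N) nrm (a j n) ^+ 2 <= 1 :> R.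
  apply: le_trans (_ : \sum_(0 <= n < maxn N (M j.+1)) nrm (a j n) ^+ 2 <= 1).
    rewrite [leRHS](big_cat_nat _ (leq_maxl _ _))//= lerDl.
    by apply: sumr_ge0 => n _; exact: sqr_ge0.
  rewrite (big_cat_nat _ (leq_maxr _ _))//= [X in _ + X]big_nat [X in _ + X]big1 ?addr0.
    by rewrite -sqr_coef_norm expr_le1 ?coef_norm_ge0 ?a1.
  move=> n /andP[Mn _]; rewrite a_supp ?nrm0 ?expr0n//.
  by rewrite negb_and -leqNgt Mn orbT.
have a_le1 j n : nrm (a j n) <= 1 by exact: coef_le1 (a_sq j n.+1) (ltnSn n).
pose eps : R := 1 / (256 * 6 * C).
have eps0 : 0 < eps by rewrite divr_gt0// !mulr_gt0.
have [r0 r00 lowP] := @low_norm_small R s I eps eps0.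
pose J := (Num.truncn (r0 ^+ 2)).+1; pose r : R := Num.sqrt J%:R.
have r2 : r ^+ 2 = J%:R by rewrite sqr_sqrtr.
have rr0 : r0 <= r.
  rewrite -(@ler_sqr R) ?nnegrE ?sqrtr_ge0 ?(ltW r00)// r2.
  exact/ltW/truncnS_gt.
pose L := M J; pose x j := P (lowv L j).
have M_le j : (j < J)%N -> (M j.+1 <= L)%N.
  move=> jJ; rewrite /L -(subnK jJ); elim: (J - j.+1)%N => // d IH.
  exact: leq_trans IH (Mnd _).
have xn j : (j < J)%N -> 1 / 16 <= nrm (x j).
  move=> /M_le jL; rewrite /x /lowv (block_vec_pad (M := M j.+1))//; first exact: a_low.
  move=> n k Mn; apply: low_eq0; apply: a_supp.
  by rewrite negb_and -leqNgt Mn orbT.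
have /choice[Nx NxP] (j : nat) : exists N, (j < J)%N ->
    1 / 256 <= coef_norm N (fun n => g n (x j)).
  have [jJ|] := boolP (j < J)%N; last by exists 0%N.
  have xj0 : x j != 0.
    by apply/eqP => e; have := xn j jJ; rewrite e nrm0; lra.
  have [N xN] := nrm_le_coef (PinY _) xj0.
  exists N => _; have := xn j jJ; move: xN; rewrite -/(x j); lra.
pose N := (\max_(j < J) Nx j)%N.
have xN j : (j < J)%N -> 1 / 256 <= coef_norm N (fun n => g n (x j)).
  move=> jJ; apply: le_trans (NxP j jJ) _; apply: le_coef_norm.
  exact: (@leq_bigmax _ (fun i : 'I_J => Nx i) (Ordinal jJ)).
have [e [e1 eP]] := @exists_signs R s N J (fun j n => g n (x j)).
pose y : V := P (embed (block_vec L (low I (assemble a e J)))).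
have yE : y = \sum_(0 <= j < J) e j *: x j.
  rewrite /y (block_vec_low_assemble Mnd a_supp e1) (lin_sum embed_linear) (lin_sum Pl).
  by apply: eq_bigr => j _; rewrite (linZ embed_linear) (linZ Pl).
have gy : (fun n => \sum_(0 <= j < J) e j * g n (x j)) = (fun n => g n y).
  apply/funext => n; rewrite yE (lin_sum (gl n)); apply: eq_bigr => j _.
  by rewrite (linZ (gl n)).
have y_small : nrm y <= C * (eps * r).
  apply: le_trans (PC _) _; rewrite ler_pM2l// nrm_embed; apply: lowP => //.
    by move=> n _; exact: (assemble_le1 Mnd a_supp e1).
  by rewrite r2; apply: (assemble_sqr_le Mnd a_supp e1) => j; exact: a_sq.
have := coef_le_nrm N (PinY (embed (block_vec L (low I (assemble a e J))))).
rewrite -/y => y_coef; rewrite gy in eP.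
have r_gt0 : 0 < r by exact: lt_le_trans r00 rr0.
have Ce : C * (eps * r) = r / (256 * 6).
  by rewrite /eps; field; rewrite gt_eqF.
have : (coef_norm N (fun n => g n y)) ^+ 2 <= (3 * (r / (256 * 6))) ^+ 2.
  rewrite ler_sqr ?nnegrE ?coef_norm_ge0//; last by lra.
  by rewrite (le_trans y_coef)// ler_pM2l// -Ce.
have : J%:R * (1 / 256) ^+ 2 <= \sum_(0 <= j < J) coef_norm N (fun n => g n (x j)) ^+ 2 :> R.
  rewrite (_ : J%:R * _ = \sum_(0 <= j < J) (1 / 256) ^+ 2); last first.
    by rewrite sumr_const_nat subn0 mulr_natl.
  rewrite big_nat [leRHS]big_nat; apply: ler_sum => j /andP[_ jJ].
  by rewrite ler_sqr ?nnegrE ?coef_norm_ge0 ?divr_ge0// xN.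
rewrite -r2; have : 0 < r ^+ 2 by rewrite exprn_gt0.
move: eP; lra.
Qed.

End NotSubprojective.

Section CompletedTensor.
Context {R : realType} {s : scalars}.
Local Notation K := (scalar_field R s).
Local Notation H := (ell2 R s).
Local Notation N := (normed_tensor (level_norm (R := R) (s := s)) H H).

Definition embed (x : tensor H H) : completion N := completion_embed (x : N).

Lemma embed_linear : linear embed.
Proof. by move=> a u v; exact: (@completion_embed_linear R s N a u v). Qed.

Lemma nrm_embed x : nrm (embed x) = level_norm H H x.
Proof. by rewrite nrm_completion_embed /nrm ofRK. Qed.

Lemma coef_extension : exists g : nat -> completion N -> K^o, forall n,
  [/\ linear (g n), forall x, nrm (g n x) <= nrm x & forall x, g n (embed x) = coef n x].
Proof.
suff /choice : forall n, exists gn : completion N -> K^o, [/\ linear gn,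
    forall x, nrm (gn x) <= nrm x & forall x, gn (embed x) = coef n x].
  by move=> [g gP]; exists g.
move=> n; apply: (@functional_extension R s N (coef n)).
  by move=> a u v; exact: (entry_linear (n, 0, 0)%N a u v).
by move=> v; rewrite [leRHS]/nrm ofRK; exact: entry_le_norm.
Qed.

Lemma completed_tensor_not_subprojective :
  ~ subprojective (completed_tensor (level_norm (R := R) (s := s)) H H).
Proof.
have [g gP] := coef_extension => sub.
have Yc := hilbert_space_closed embed_linear.
have Yinf := hilbert_space_infinite gP.
have [Z [ZY Zc Zinf Zcompl]] := sub _ Yc Yinf.
exact: (no_complemented_subspace embed_linear nrm_embed gP ZY Zc Zinf Zcompl).
Qed.

End CompletedTensor.

Theorem proposition3p8 (R : realType) (s : scalars) :
  exists alpha : tensor_norm R s,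
    (forall X Y : completeNormedModType (scalar_field R s),
       is_banach (completed_tensor alpha X Y)) /\
    ~ subprojective (completed_tensor alpha (ell2 R s) (ell2 R s)).
Proof.
exists (level_norm (R := R) (s := s)); split; last exact: completed_tensor_not_subprojective.
by move=> X Y; exact: completion_banach.
Qed.
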